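(* Suppose that for every point $p$ of the set of desired formations $$\{(p_1^{\top},\ldots,p_N^{\top})^{\top}\in\mathbb{R}^{nN} \mid \forall\, ij\in\mathcal{E}\colon \|p_j-p_i\|=d_{ij}\},$$ the framework $\mathcal{G}(p)$ is infinitesimally rigid. Then there exist $L,\lambda,\mu>0$ such that for every $x_0\in\mathbb{R}^{2nN}$ with $E(x_0)\leq L$, the maximal solution $x=(p^{\top},v^{\top})^{\top}$ of the system $$\dot{p}_i = v_i,\qquad \dot{v}_i = -r_i\,v_i-\nabla_{p_i}V_i(p),\qquad i=1,\ldots,N,$$ with $x(0)=x_0$ satisfies $$E(x(t))\ \leq\ \lambda\,E(x_0)\,\mathrm{e}^{-\mu t}$$ for every $t\geq 0$ (in particular, it is defined for all $t\ge 0$).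
   Context: Let $n,N$ be positive integers with $N\geq n$. $\|\cdot\|$ is the Euclidean norm. Let $\mathcal{G}=(\mathcal{V},\mathcal{E})$ be an undirected graph with vertex set $\mathcal{V}=\{1,\ldots,N\}$ and nonempty edge set $\mathcal{E}$ of two-element subsets of $\mathcal{V}$; an edge $\{i,j\}$ is written $ij$. Let $M$ be the number of edges. For $p=(p_1^{\top},\ldots,p_N^{\top})^{\top}\in\mathbb{R}^{nN}$ with $p_i\in\mathbb{R}^n$, the pair $\mathcal{G}(p)$ consisting of $\mathcal{G}$ and $p$ is called a framework. The edge map $f_{\mathcal{G}}\colon\mathbb{R}^{nN}\to\mathbb{R}^M$ is $f_{\mathcal{G}}(p)=(\ldots,\|p_j-p_i\|^2,\ldots)_{ij\in\mathcal{E}}^{\top}$ (for some fixed ordering of the edges). The framework $\mathcal{G}(p)$ is infinitesimally rigid if the rank of the derivative of $f_{\mathcal{G}}$ at $p$ equals $nN-n(n+1)/2$. For each edge $ij\in\mathcal{E}$ let $d_{ij}>0$ be a given real number (desired distance); it is assumed that these distances are realizable in $\mathbb{R}^n$, i.e. the set of desired formations is nonempty. Let $r_1,\ldots,r_N>0$ be given constants. For each $i$ define $$V_i(p)=\frac14\sum_{j\colon ij\in\mathcal{E}}\big(\|p_j-p_i\|^2-d_{ij}^2\big)^2,$$ and let $\nabla_{p_i}V_i(p)\in\mathbb{R}^n$ be the gradient of $V_i$ with respect to $p_i$. The total energy $E\colon\mathbb{R}^{2nN}\to\mathbb{R}$ is $$E(x)=\frac12\|v\|^2+V(p),\qquad V(p)=\frac14\sum_{ij\in\mathcal{E}}\big(\|p_j-p_i\|^2-d_{ij}^2\big)^2,$$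 for $x=(p^{\top},v^{\top})^{\top}$ with $p=(p_1^{\top},\ldots,p_N^{\top})^{\top}$, $v=(v_1^{\top},\ldots,v_N^{\top})^{\top}\in\mathbb{R}^{nN}$ (each edge is counted once in $V$). *)

(* Defs.v *)
From HB Require Import structures.
From mathcomp Require Import all_boot all_order all_algebra.
From mathcomp Require Import all_classical all_reals all_analysis.

Set Implicit Arguments.
Unset Strict Implicit.
Unset Printing Implicit Defensive.

Import Order.TTheory GRing.Theory Num.Theory numFieldNormedType.Exports.
Local Open Scope classical_set_scope.
Local Open Scope ring_scope.

(* Vectors are row vectors.  R^(nN) is 'rV[R]_(N * n), whose coordinates list
   p_1, ..., p_N consecutively; R^(2nN) is 'rV[R]_(N * n + N * n), with (p, v)
   encoded as row_mx p v.  Vertices are numbered from 0 to N - 1. *)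

(* The library norm `|u| on 'rV[R]_k is the max norm, hence this definition. *)
Definition enorm (R : realType) (k : nat) (u : 'rV[R]_k) : R :=
  Num.sqrt (\sum_(c < k) u 0 c ^+ 2).

Definition block (R : realType) (N n : nat) (p : 'rV[R]_(N * n)) (i : 'I_N) :
  'rV[R]_n := row i (vec_mx p).

(* A graph is given by its edge set G : {set {set 'I_N}}, consisting of
   two-element sets.  The pairs below list every edge {i, j} exactly once,
   as (i, j) with i < j. *)
Definition edge_pairs (N : nat) (G : {set {set 'I_N}}) : {set 'I_N * 'I_N} :=
  [set ij : 'I_N * 'I_N | (ij.1 < ij.2)%N & [set ij.1; ij.2] \in G]%SET.

(* The edges are ordered by the enumeration of edge_pairs G. *)
Definition edge_map (R : realType) (N n : nat) (G : {set {set 'I_N}})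
    (p : 'rV[R]_(N * n)) : 'rV[R]_#|edge_pairs G| :=
  \row_k enorm (block p (enum_val k).2 - block p (enum_val k).1) ^+ 2.

Definition infinitesimally_rigid (R : realType) (N n : nat)
    (G : {set {set 'I_N}}) (p : 'rV[R]_(N * n)) : Prop :=
  \rank ('J (@edge_map R N n G) p) = (n * N - (n * n.+1) %/ 2)%N.

(* The distance d_ij is d [set i; j], so that it depends on the edge only. *)
Definition desired_formations (R : realType) (N n : nat)
    (G : {set {set 'I_N}}) (d : {set 'I_N} -> R) : set 'rV[R]_(N * n) :=
  [set p | forall i j : 'I_N, [set i; j]%SET \in G ->
           enorm (block p j - block p i) = d [set i; j]%SET].

Definition local_potential (R : realType) (N n : nat) (G : {set {set 'I_N}})
    (d : {set 'I_N} -> R) (i : 'I_N) (p : 'rV[R]_(N * n)) : R :=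
  4^-1 * \sum_(j < N | [set i; j]%SET \in G)
    (enorm (block p j - block p i) ^+ 2 - d [set i; j]%SET ^+ 2) ^+ 2.

(* Gradient with respect to p_i: mxvec (delta_mx i k) is the basis vector of
   R^(nN) for the k-th coordinate of p_i. *)
Definition block_gradient (R : realType) (N n : nat) (i : 'I_N)
    (f : 'rV[R]_(N * n) -> R) (p : 'rV[R]_(N * n)) : 'rV[R]_n :=
  \row_k 'D_(mxvec (delta_mx i k)) f p.

Definition potential (R : realType) (N n : nat) (G : {set {set 'I_N}})
    (d : {set 'I_N} -> R) (p : 'rV[R]_(N * n)) : R :=
  4^-1 * \sum_(ij in edge_pairs G)
    (enorm (block p ij.2 - block p ij.1) ^+ 2
     - d [set ij.1; ij.2]%SET ^+ 2) ^+ 2.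

Definition energy (R : realType) (N n : nat) (G : {set {set 'I_N}})
    (d : {set 'I_N} -> R) (x : 'rV[R]_(N * n + N * n)) : R :=
  2^-1 * enorm (rsubmx x) ^+ 2 + potential G d (lsubmx x).

(* x : R -> R^(2nN) is a solution on the open interval J around 0 with
   x(0) = x0; the values of x outside J are irrelevant. *)
Definition is_solution (R : realType) (N n : nat) (G : {set {set 'I_N}})
    (d : {set 'I_N} -> R) (r : 'I_N -> R) (x0 : 'rV[R]_(N * n + N * n))
    (J : set R) (x : R -> 'rV[R]_(N * n + N * n)) : Prop :=
  [/\ open J, is_interval J, J 0, x 0 = x0 &
      forall (t : R) (i : 'I_N), J t ->
        is_derive t (1 : R) (fun s => block (lsubmx (x s)) i)
          (block (rsubmx (x t)) i) /\
        is_derive t (1 : R) (fun s => block (rsubmx (x s)) i)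
          (- (r i *: block (rsubmx (x t)) i)
           - block_gradient i (local_potential G d i) (lsubmx (x t)))].

Definition is_maximal_solution (R : realType) (N n : nat)
    (G : {set {set 'I_N}}) (d : {set 'I_N} -> R) (r : 'I_N -> R)
    (x0 : 'rV[R]_(N * n + N * n))
    (J : set R) (x : R -> 'rV[R]_(N * n + N * n)) : Prop :=
  is_solution G d r x0 J x /\
  forall (J' : set R) (x' : R -> 'rV[R]_(N * n + N * n)),
    is_solution G d r x0 J' x' -> J `<=` J' ->
    (forall t, J t -> x' t = x t) -> J' = J.

(* Main.v *)
Require Import Defs.
From HB Require Import structures.
From mathcomp Require Import all_boot all_order all_algebra.
From mathcomp Require Import all_classical all_reals all_analysis.
From mathcomp Require Import ring lra zify.
Import Order.TTheory GRing.Theory Num.Theory numFieldNormedType.Exports.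
Local Open Scope classical_set_scope.
Local Open Scope ring_scope.
Set Implicit Arguments.
Unset Strict Implicit.
Unset Printing Implicit Defensive.

(* The kinetic-plus-potential energy decreases along solutions; to obtain an
   exponential rate one perturbs it to W = E + eps <v, grad V>, which is a strict
   Lyapunov function as soon as |grad V|^2 >= V / kappa on a sublevel set of V.

   For this inequality let Q be the desired formation nearest to P.  Desired
   formations are permuted by rigid motions, so U = P - Q is orthogonal to the
   translations and infinitesimal rotations of Q.  Infinitesimal rigidity means
   that these exhaust the kernel of the derivative of the edge map at Q, hence
   |U|^2 is bounded by the squared edge errors, and pairing the gradient with U
   gives the claim.  Rigidity also forces the graph to be connected, so
   compactness modulo translations makes the constants uniform.

   The energy grows at most exponentially in backward time, hence every initial
   state has a solution on the whole real line; by uniqueness it is the maximal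
   one. *)

(** * Scalar calculus *)

(** The derivative of the energy contains velocities only, so the energy itself cannot bound its own
    decay. The cross term contributes the missing [- eps * |grad V|^2]; its other parts, a Hessian
    term and a friction term, cost [eps * |v|^2] and half of that gain, which friction and the
    remaining half pay for when [eps] is small.

    Formations come in families, and along them the derivative of the edge map degenerates; for an
    arbitrary nearby formation [P - Q] could lie in the kernel. For the nearest one, orthogonality
    is just optimality against explicit translations and plane rotations, so no manifold structure
    of the formation set is needed.

    The infinitesimal rotations of [Q] may be dependent when [Q] lies in a small affine subspace, so
    their dimension is never computed. Instead the space orthogonal to the trivial motions is
    bounded from above by pinning [n (n + 1) / 2] coordinates of an affine frame. A hyperplane must
    be allowed, since [N = n] points span no more.

    A maximal solution also lives at negative times, where friction feeds energy; hence the a priori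
    bounds are stated for both directions of time. *)

Section ScalarCalculus.
Context {R : realType} {V : normedModType R}.
Implicit Types (f g : V -> R) (x v : V).

Lemma derive_ptD f g x v df dg : is_derive x v f df -> is_derive x v g dg ->
  is_derive x v (fun y => f y + g y) (df + dg).
Proof. by move=> hf hg; exact: is_deriveD. Qed.

Lemma derive_ptN f x v df : is_derive x v f df ->
  is_derive x v (fun y => - f y) (- df).
Proof. by move=> hf; exact: is_deriveN. Qed.

Lemma derive_ptB f g x v df dg : is_derive x v f df -> is_derive x v g dg ->
  is_derive x v (fun y => f y - g y) (df - dg).
Proof. by move=> hf hg; exact: is_deriveB. Qed.

Lemma derive_ptM f g x v df dg : is_derive x v f df -> is_derive x v g dg ->
  is_derive x v (fun y => f y * g y) (f x * dg + g x * df).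
Proof. by move=> hf hg; exact: is_deriveM. Qed.

Lemma derive_ptZ c f x v df : is_derive x v f df ->
  is_derive x v (fun y => c * f y) (c * df).
Proof. by move=> hf; exact: is_deriveZ. Qed.

Lemma derive_pt_sum (I : finType) (P : pred I) (f : I -> V -> R) x v
    (df : I -> R) : (forall i, P i -> is_derive x v (f i) (df i)) ->
  is_derive x v (fun y => \sum_(i | P i) f i y) (\sum_(i | P i) df i).
Proof.
move=> hf.
have -> : (fun y => \sum_(i | P i) f i y) = \sum_(i | P i) f i.
  by apply/funext => y; rewrite fct_sumE.
by elim/big_ind2 : _ => // [|] *; [exact: is_derive_cst|exact: is_deriveD].
Qed.

End ScalarCalculus.

Section RealCalculus.
Context {R : realType}.
Implicit Types (f g : R -> R).

Lemma derive_pt_expM (c t : R) :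
  is_derive t 1 (fun s => expR (c * s)) (c * expR (c * t)).
Proof.
have h : is_derive t 1 (fun s : R => c * s) (c * 1) by apply: derive_ptZ.
have := is_derive1_comp (f := expR) (is_derive_expR (c * t)) h.
by rewrite mulr1 => H; apply: is_derive_eq (H) _; rewrite mulrC.
Qed.

Lemma derive_pt_opp f (t df : R) : is_derive (- t) 1 f df ->
  is_derive t 1 (fun s => f (- s)) (- df).
Proof.
move=> h.
have := is_derive1_comp (f := f) h (is_deriveNid t 1).
by rewrite mulrN1.
Qed.

Lemma derive_nonpos_le f (df : R -> R) (a b : R) : a <= b ->
  (forall t, a <= t <= b -> is_derive t 1 f (df t)) ->
  (forall t, a <= t <= b -> df t <= 0) -> f b <= f a.
Proof.
move=> ab hf hdf.
have [c cab] : exists2 c, c \in `[a, b]%R & f b - f a = df c * (b - a).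
  apply: (MVT_segment (df := df)) => //.
    by move=> t; rewrite ?in_itv /= => /andP[/ltW at_ /ltW tb]; apply: hf;
       rewrite at_ tb.
  apply: (derivable_within_continuous (i := `[a, b]%R)) => t; rewrite in_itv /= => tab.
  by have [] := hf t tab.
move: cab; rewrite in_itv /= => /hdf hc; rewrite -subr_le0 => ->.
by rewrite mulr_le0_ge0 // subr_ge0.
Qed.

Lemma gronwall_le f (df : R -> R) (c T : R) : 0 <= T ->
  (forall t, 0 <= t <= T -> is_derive t 1 f (df t)) ->
  (forall t, 0 <= t <= T -> df t <= c * f t) -> f T <= f 0 * expR (c * T).
Proof.
move=> T0 hf hdf.
have : f T * expR (- c * T) <= f 0 * expR (- c * 0).
  apply: (@derive_nonpos_le (fun t => f t * expR (- c * t))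
    (fun t => f t * (- c * expR (- c * t)) + expR (- c * t) * df t)) => //.
    by move=> t /hf ht; apply: derive_ptM => //; exact: derive_pt_expM.
  move=> t /hdf ht.
  have -> : f t * (- c * expR (- c * t)) + expR (- c * t) * df t =
    expR (- c * t) * (df t - c * f t) by ring.
  by rewrite mulr_ge0_le0 ?expR_ge0 // subr_le0.
rewrite mulr0 expR0 mulr1 mulNr expRN -ler_pdivlMr ?invr_gt0 ?expR_gt0 //.
by rewrite invrK.
Qed.

(** The bound on [df] is the derivative of [a * expR (k * t)], and [a >= 0 = f 0]. This is the
    estimate behind the exponentially weighted norm of the Picard iteration; with [a = 0] it says
    that a function with zero derivative stays zero. *)
Lemma derive_exp_bound_ge0 f (df : R -> R) (a k T : R) : 0 <= T -> 0 <= a ->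
  f 0 = 0 -> (forall t, 0 <= t <= T -> is_derive t 1 f (df t)) ->
  (forall t, 0 <= t <= T -> `|df t| <= a * (k * expR (k * t))) ->
  `|f T| <= a * expR (k * T).
Proof.
move=> T0 a0 f0 hf hdf; rewrite ler_norml; apply/andP; split.
- have : - f T - a * expR (k * T) <= - f 0 - a * expR (k * 0).
    apply: (@derive_nonpos_le (fun t => - f t - a * expR (k * t))
      (fun t => - df t - a * (k * expR (k * t)))) => // t tT.
      apply: derive_ptB; first by apply: derive_ptN; exact: hf.
      by apply: derive_ptZ; exact: derive_pt_expM.
    by have := hdf t tT; rewrite ler_norml => /andP[h _]; lra.
  by rewrite f0 mulr0 expR0; lra.
- have : f T - a * expR (k * T) <= f 0 - a * expR (k * 0).
    apply: (@derive_nonpos_le (fun t => f t - a * expR (k * t))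
      (fun t => df t - a * (k * expR (k * t)))) => // t tT.
      apply: derive_ptB; first exact: hf.
      by apply: derive_ptZ; exact: derive_pt_expM.
    by have := hdf t tT; rewrite ler_norml => /andP[_ h]; lra.
  by rewrite f0 mulr0 expR0; lra.
Qed.

Lemma derive_exp_bound_local f (df : R -> R) (a k t : R) : 0 <= a ->
  f 0 = 0 -> (forall s : R, `|s| <= `|t| -> is_derive s 1 f (df s)) ->
  (forall s, `|s| <= `|t| -> `|df s| <= a * (k * expR (k * `|s|))) ->
  `|f t| <= a * expR (k * `|t|).
Proof.
move=> a0 f0 hf hdf; case: (leP 0 t) => [t0|/ltW t0].
  have h s : 0 <= s <= t -> `|s| <= `|t|.
    by move=> /andP[s0 st]; rewrite !ger0_norm.
  rewrite (ger0_norm t0); apply: (derive_exp_bound_ge0 t0 a0 f0 (df := df)) => s st.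
    exact/hf/h.
  by have := hdf s (h s st); rewrite (ger0_norm (x := s)) //; case/andP: st.
have h s : 0 <= s <= - t -> `|- s| <= `|t|.
  by move=> /andP[s0 st]; rewrite normrN ger0_norm // ler0_norm.
rewrite (ler0_norm t0) -{1}[t]opprK.
apply: (@derive_exp_bound_ge0 (fun s => f (- s)) (fun s => - df (- s))) => //.
- by rewrite oppr_ge0.
- by rewrite oppr0.
- by move=> s /h st; apply: derive_pt_opp; exact: hf.
- move=> s st; have := hdf (- s) (h s st).
  by rewrite !normrN (ger0_norm (x := s)) //; case/andP: st.
Qed.

Lemma derive_exp_bound f (df : R -> R) (a k : R) : 0 <= a ->
  f 0 = 0 -> (forall t : R, is_derive t 1 f (df t)) ->
  (forall t, `|df t| <= a * (k * expR (k * `|t|))) ->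
  forall t, `|f t| <= a * expR (k * `|t|).
Proof. by move=> a0 f0 hf hdf t; exact: derive_exp_bound_local. Qed.

Lemma exhaustion_glue (T : Type) (Y : nat -> R -> T) :
  (forall n m s, `|s| < n.+1%:R -> `|s| < m.+1%:R -> Y n s = Y m s) ->
  exists y : R -> T, forall n s, `|s| < n.+1%:R -> y s = Y n s.
Proof.
move=> agree; exists (fun s => Y (Num.Def.archi_bound `|s|) s) => n s sn.
apply: agree => //; apply: lt_trans (archi_boundP (normr_ge0 s)) _.
by rewrite ltr_nat.
Qed.

Lemma exhaustion_near (t : R) : exists n : nat, \forall s \near t, `|s| < n.+1%:R.
Proof.
exists (Num.Def.archi_bound `|t|); apply: (@cvgr_norm_lt R R R (nbhs t) _ id t) => //.
by apply: lt_trans (archi_boundP (normr_ge0 t)) _; rewrite ltr_nat.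
Qed.

(** The integral needs a fixed left endpoint, so the fundamental theorem of calculus only serves a
    bounded interval. The primitives on growing intervals, normalised to vanish at 0, agree on
    overlaps and are glued. *)
Lemma primitive_exists f : continuous f ->
  exists F : R -> R, F 0 = 0 /\ forall t : R, is_derive t 1 F (f t).
Proof.
move=> cf.
have prim (a : R) : 0 < a -> exists F : R -> R, F 0 = 0 /\
    forall t : R, - a < t < a -> is_derive t 1 F (f t).
  move=> a0; pose mu := @lebesgue_measure R.
  pose G (x : R) := (\int[mu]_(t in [set` `[- a, x]]) f t)%R.
  exists (fun t => G t - G 0); split; first by rewrite subrr.
  move=> t /andP[ta1 ta2]; rewrite -[f t]subr0; apply: derive_ptB.
  have int_f : mu.-integrable `[- a, a] (EFin \o f).
    apply: continuous_compact_integrable; first exact: segment_compact.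
    exact: continuous_subspaceT.
  have [//|h1 h2] := continuous_FTC1_closed ta2 int_f ta1.
    exact: cf.
  by rewrite -h2 derive1E; apply: DeriveDef.
have /choice[F hF] : forall n : nat, exists F : R -> R, F 0 = 0 /\
    forall t : R, - n.+1%:R < t < n.+1%:R -> is_derive t 1 F (f t).
  by move=> n; exact: prim.
have agree n m s : `|s| < n.+1%:R -> `|s| < m.+1%:R -> F n s = F m s.
  move=> sn sm; have [Fn0 Fn] := hF n; have [Fm0 Fm] := hF m.
  apply/eqP; rewrite -subr_eq0 -normr_le0; apply: (@le_trans _ _ (0 * expR (1 * `|s|))); last by rewrite mul0r.
  apply: (@derive_exp_bound_local (fun t => F n t - F m t) (fun t => f t - f t)) => //.
  - by rewrite Fn0 Fm0 subrr.
  - move=> t ts; apply: derive_ptB; [apply: Fn|apply: Fm].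
      by rewrite -ltr_norml; exact: le_lt_trans sn.
    by rewrite -ltr_norml; exact: le_lt_trans sm.
  - by move=> t _; rewrite subrr normr0 mul0r.
have [G hG] := exhaustion_glue agree.
exists G; split; first by rewrite (hG 0%N) ?normr0 ?ltr01 //; have [] := hF 0%N.
move=> t; have [n tn] := exhaustion_near t.
apply: (near_eq_is_derive (f := F n)).
  by near=> s; apply/esym/hG; near: s.
have [_] := hF n; apply; rewrite -ltr_norml.
exact: nbhs_singleton tn.
Unshelve. all: by end_near. Qed.
End RealCalculus.

(** * Picard iteration for bounded Lipschitz fields *)

Section RowNorm.
Context {R : realType} {m : nat}.
Implicit Types u : 'rV[R]_m.

Lemma rV_normP u (c : R) : 0 <= c -> (forall j, `|u 0 j| <= c) <-> `|u| <= c.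
Proof.
move=> c0; rewrite [`|u|]/Num.Def.normr /= mx_normrE; split=> h.
  by apply: bigmax_le => // -[i j] _; rewrite /= ord1.
by move=> j; apply: le_trans h; exact: (le_bigmax _ _ (0, j)).
Qed.

Lemma rV_coord_le u j : `|u 0 j| <= `|u|.
Proof. by move: j; apply/rV_normP. Qed.

End RowNorm.

Section Limits.
Context {R : realType}.

Lemma geometric_squeeze (x b a : R) :
  (forall k : nat, x <= b + a * 2^-1 ^+ k) -> x <= b.
Proof.
move=> h; rewrite leNgt; apply/negP => bx.
pose n := Num.Def.archi_bound (`|a| / (x - b)).
have n_gt : `|a| / (x - b) < n%:R.
  by apply: archi_boundP; rewrite divr_ge0 // subr_ge0 ltW.
have n2 : (n%:R : R) <= 2 ^+ n by rewrite -natrX ler_nat ltnW // ltn_expl.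
have := h n; rewrite exprVn; have p2 : (0 : R) < 2 ^+ n by rewrite exprn_gt0.
move=> {}h; have : (x - b) * 2 ^+ n <= a.
  by rewrite -ler_pdivlMr //; lra.
move: n_gt; rewrite ltr_pdivrMr ?subr_gt0 // => n_gt {}h.
have : a <= `|a| by exact: ler_norm.
have : n%:R * (x - b) <= 2 ^+ n * (x - b) by rewrite ler_wpM2r // subr_ge0 ltW.
lra.
Qed.

(** With [e k] the tail of the geometric series from [k] on, the intervals from [u k - e k] to
    [u k + e k] are nested; [l] is the supremum of their left endpoints. *)
Lemma geometric_limit (u : nat -> R) (a : R) : 0 <= a ->
  (forall k, `|u k.+1 - u k| <= a * 2^-1 ^+ k) ->
  exists l, forall k, `|l - u k| <= 2 * a * 2^-1 ^+ k.
Proof.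
move=> a0 hu; pose e k : R := 2 * a * 2^-1 ^+ k.
have e0 k : 0 <= e k by rewrite !mulr_ge0 // exprn_ge0.
have eS k : e k.+1 = a * 2^-1 ^+ k by rewrite /e exprS; field.
have eS2 k : e k = 2 * e k.+1 by rewrite eS /e mulrA.
have lo k j : u k - e k <= u (k + j)%N - e (k + j)%N.
  elim: j => [|j ih]; first by rewrite addn0.
  apply: le_trans ih _; rewrite addnS; have := hu (k + j)%N.
  by rewrite -eS ler_norml (eS2 (k + j)%N) => /andP[h1 h2]; lra.
have hi k j : u (k + j)%N + e (k + j)%N <= u k + e k.
  elim: j => [|j ih]; first by rewrite addn0.
  apply: le_trans ih; rewrite addnS; have := hu (k + j)%N.
  by rewrite -eS ler_norml (eS2 (k + j)%N) => /andP[h1 h2]; lra.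
have lohi j k : u j - e j <= u k + e k.
  apply: le_trans (lo j k) _; rewrite addnC; apply: le_trans (hi k j).
  by have := e0 (k + j)%N; lra.
pose S := range (fun k => u k - e k).
exists (sup S) => k; rewrite ler_norml; apply/andP; split.
  suff : u k - e k <= sup S by rewrite /e; lra.
  apply: ub_le_sup; last by exists k.
  by exists (u 0%N + e 0%N) => _ [j _ <-].
suff : sup S <= u k + e k by rewrite /e; lra.
by apply: ge_sup; [exists (u 0%N - e 0%N); exists 0%N|move=> _ [j _ <-]].
Qed.

Lemma lipschitz_continuous (V W : normedModType R) (f : V -> W) (c : R) :
  (forall t s, `|f t - f s| <= c * `|t - s|) -> continuous f.
Proof.
move=> h t; apply/cvgrPdist_lt => e e0; near=> s.
apply: le_lt_trans (h t s) _.
have c1 : 0 < `|c| + 1 by rewrite ltr_wpDl.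
apply: (@le_lt_trans _ _ ((`|c| + 1) * `|t - s|)).
  by rewrite ler_wpM2r // (le_trans (ler_norm _)) // lerDl.
rewrite mulrC -ltr_pdivlMr //; near: s.
have h0 : 0 < e / (`|c| + 1) by rewrite divr_gt0.
exact: (@cvgr_dist_lt _ _ _ (nbhs t) _ id t).
Unshelve. all: by end_near. Qed.

Lemma derive_bound_lipschitz (f : R -> R) (df : R -> R) (c : R) :
  (forall t : R, is_derive t 1 f (df t)) -> (forall t, `|df t| <= c) ->
  forall t s, `|f t - f s| <= c * `|t - s|.
Proof.
move=> hf hdf t s; wlog st : t s / s <= t.
  by case: (leP s t) => [st ->//|/ltW ts /(_ s t ts)]; rewrite distrC (distrC s).
have dZ (x : R) : is_derive x 1 (fun y : R => c * y) (c * 1) by apply: derive_ptZ.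
rewrite (ger0_norm (x := t - s)) ?subr_ge0 // ler_norml; apply/andP; split.
- have : - f t - c * t <= - f s - c * s.
    apply: (@derive_nonpos_le _ (fun t => - f t - c * t)
      (fun t => - df t - c * 1)) => // x _.
    by have := hdf x; rewrite ler_norml => /andP[h1 h2]; lra.
  lra.
- have : f t - c * t <= f s - c * s.
    apply: (@derive_nonpos_le _ (fun t => f t - c * t)
      (fun t => df t - c * 1)) => // x _.
    by have := hdf x; rewrite ler_norml => /andP[h1 h2]; lra.
  lra.
Qed.

End Limits.

Section Picard.
Context {R : realType} {m : nat}.
Variables (F : 'rV[R]_m -> 'rV[R]_m) (K B : R).
Hypotheses (K_gt0 : 0 < K) (B_ge0 : 0 <= B).
Hypothesis F_lip : forall x y, `|F x - F y| <= K * `|x - y|.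
Hypothesis F_bound : forall x, `|F x| <= B.
Variable x0 : 'rV[R]_m.

(** The Picard operator in differential form. It is a relation because a primitive is only at hand
    when [y] is regular enough for [F (y t)] to be continuous. *)
Definition picard_step (y z : R -> 'rV[R]_m) : Prop :=
  z 0 = x0 /\
  forall (t : R) c, is_derive t (1 : R) (fun s => z s 0 c) (F (y t) 0 c).

Let lip (y : R -> 'rV[R]_m) := forall t s, `|y t - y s| <= B * `|t - s|.

Let picard_step_exists y : lip y -> exists z, picard_step y z.
Proof.
move=> ylip.
have prim c : exists f : R -> R, f 0 = 0 /\
    forall t : R, is_derive t 1 f (F (y t) 0 c).
  apply: primitive_exists.
  apply: (@lipschitz_continuous _ _ _ _ (K * B)) => t s.
  apply: (@le_trans _ _ `|F (y t) - F (y s)|).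
    by have := rV_coord_le (F (y t) - F (y s)) c; rewrite !mxE.
  by apply: le_trans (F_lip _ _) _; rewrite -mulrA ler_wpM2l // ltW.
have [f hf] := choice prim.
exists (fun t => \row_c (x0 0 c + f c t)); split.
  by apply/rowP => c; rewrite mxE (hf c).1 addr0.
move=> t c; have -> : (fun s => (\row_c0 (x0 0 c0 + f c0 s)) 0 c) =
   (fun s => x0 0 c + f c s) by apply/funext => s; rewrite mxE.
rewrite -[F (y t) 0 c]add0r; apply: derive_ptD; exact: (hf c).2.
Qed.

Let picard_step_lip y z : picard_step y z -> lip z.
Proof.
move=> [_ hz] t s; apply/rV_normP; first by rewrite mulr_ge0.
move=> c; rewrite !mxE.
apply: (@derive_bound_lipschitz _ (fun t => z t 0 c)
  (fun t => F (y t) 0 c)) => // x.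
exact: le_trans (rV_coord_le _ _) (F_bound _).
Qed.

(** In the norm with weight [expR (- 2 * K * |t|)] the Picard step halves distances, because
    integrating [K * 2 * a * expR (2 * K * s)] gains a factor [2 * K]. The iteration therefore
    converges on the whole line at once, with no short time steps. *)
Let picard_step_contract y y' z z' a : 0 <= a ->
  picard_step y z -> picard_step y' z' ->
  (forall t, `|y t - y' t| <= 2 * a * expR (2 * K * `|t|)) ->
  forall t, `|z t - z' t| <= a * expR (2 * K * `|t|).
Proof.
move=> a0 [z0 hz] [z0' hz'] h t; apply/rV_normP.
  by rewrite mulr_ge0 // expR_ge0.
move=> c; rewrite !mxE.
apply: (@derive_exp_bound _ (fun t => z t 0 c - z' t 0 c)
  (fun t => F (y t) 0 c - F (y' t) 0 c)) => //.
- by rewrite z0 z0' subrr.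
move=> s; have := rV_coord_le (F (y s) - F (y' s)) c; rewrite !mxE => h1.
apply: (le_trans h1); apply: le_trans (F_lip _ _) _.
have := h s; rewrite -(ler_pM2l K_gt0) => h2; apply: le_trans h2 _.
by rewrite le_eqVlt; apply/orP; left; apply/eqP; ring.
Qed.

Theorem picard_global : exists y : R -> 'rV[R]_m, y 0 = x0 /\
  forall (t : R) c, is_derive t (1 : R) (fun s => y s 0 c) (F (y t) 0 c).
Proof.
have step_ex y : exists z, lip y -> picard_step y z.
  have [/picard_step_exists[z hz]|nl] := pselect (lip y); first by exists z.
  by exists y.
have [S hS] := choice step_ex.
pose X k := iter k S (fun=> x0).
have Xlip k : lip (X k).
  elim: k => [|k ih] /=; last exact: picard_step_lip (hS _ ih).
  by move=> t s; rewrite subrr normr0 mulr_ge0.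
have Xstep k : picard_step (X k) (X k.+1) by exact: hS.
(* The first two iterates differ by at most [B * |t| = C * (2 * K * |t|)], which is below
   [C * expR (2 * K * |t|)]. *)
pose C := B / (2 * K).
have K2 : 0 < 2 * K by rewrite mulr_gt0.
have C0 : 0 <= C by rewrite divr_ge0 // ltW.
have Xdist k t : `|X k.+1 t - X k t| <= C * 2^-1 ^+ k * expR (2 * K * `|t|).
  elim: k t => [|k ih] t.
    have [h0 _] := Xstep 0%N; rewrite expr0 mulr1.
    have := Xlip 1%N t 0; rewrite h0 subr0.
    move/le_trans; apply.
    have -> : B * `|t| = C * (2 * K * `|t|).
      by rewrite /C mulrA divfK // gt_eqF.
    rewrite ler_wpM2l //; have := expR_ge1Dx (2 * K * `|t|); lra.
  apply: (picard_step_contract (y := X k.+1) (y' := X k)) => //.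
    by rewrite mulr_ge0 // exprn_ge0.
  move=> s; apply: le_trans (ih s) _.
  by rewrite exprS le_eqVlt; apply/orP; left; apply/eqP; field.
have lim t : exists l : 'rV[R]_m, forall k,
    `|l - X k t| <= 2 * (C * expR (2 * K * `|t|)) * 2^-1 ^+ k.
  have A0 : 0 <= C * expR (2 * K * `|t|) by rewrite mulr_ge0 // expR_ge0.
  have limc c : exists l : R, forall k,
    `|l - X k t 0 c| <= 2 * (C * expR (2 * K * `|t|)) * 2^-1 ^+ k.
    apply: geometric_limit => // k.
    have := rV_coord_le (X k.+1 t - X k t) c; rewrite !mxE => /le_trans; apply.
    apply: le_trans (Xdist k t) _.
    by rewrite le_eqVlt; apply/orP; left; apply/eqP; ring.
  have [l hl] := choice limc; exists (\row_c l c) => k; apply/rV_normP.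
    by rewrite mulr_ge0 ?exprn_ge0 // mulr_ge0.
  by move=> c; rewrite !mxE.
have [y hy] := choice lim.
have ylip : lip y.
  move=> t s; apply: (@geometric_squeeze _ _ _
    (2 * (C * expR (2 * K * `|t|)) + 2 * (C * expR (2 * K * `|s|)))) => k.
  have -> : y t - y s = (y t - X k t) + (X k t - X k s) - (y s - X k s).
    by rewrite addrA subrK opprB addrA subrK.
  have := ler_normB ((y t - X k t) + (X k t - X k s)) (y s - X k s).
  have := ler_normD (y t - X k t) (X k t - X k s).
  by have := hy t k; have := hy s k; have := Xlip k t s; lra.
(* The image [z] of the limit [y] is itself a limit of the iterates, by contraction, so [z = y] and
   [y] is a fixed point. *)
have [z hz] := picard_step_exists ylip.
have zX k t : `|z t - X k.+1 t| <= C * 2^-1 ^+ k * expR (2 * K * `|t|).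
  apply: (picard_step_contract (y := y) (y' := X k)) => //.
    by rewrite mulr_ge0 // exprn_ge0.
  move=> s; apply: le_trans (hy s k) _.
  by rewrite le_eqVlt; apply/orP; left; apply/eqP; ring.
have zy : z = y.
  apply/funext => t; apply/eqP; rewrite -subr_eq0 -normr_le0.
  apply: (@geometric_squeeze _ _ _ (2 * (C * expR (2 * K * `|t|)))) => k.
  have -> : z t - y t = (z t - X k.+1 t) - (y t - X k.+1 t).
    by rewrite opprB addrA subrK.
  have := ler_normB (z t - X k.+1 t) (y t - X k.+1 t).
  have := zX k t; have := hy t k.+1.
  have -> : 2 * (C * expR (2 * K * `|t|)) * 2^-1 ^+ k.+1 =
    C * 2^-1 ^+ k * expR (2 * K * `|t|) by rewrite exprS; field.
  lra.
by exists y; move: hz; rewrite zy.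
Qed.

End Picard.

(** * Locally Lipschitz differential equations *)

Section LocallyLipschitzODE.
Context {R : realType} {m : nat}.
Implicit Types (F : 'rV[R]_m -> 'rV[R]_m) (x y z : R -> 'rV[R]_m).

Definition lipschitz_on_balls F := forall b : R, exists2 K, 0 < K &
  forall u v, `|u| <= b -> `|v| <= b -> `|F u - F v| <= K * `|u - v|.

Definition ode_at F x (t : R) :=
  forall c, is_derive t (1 : R) (fun s => x s 0 c) (F (x t) 0 c).

Lemma rV_norm_sqr_le (u : 'rV[R]_m) : `|u| ^+ 2 <= \sum_c u 0 c ^+ 2.
Proof.
have s0 : 0 <= \sum_c u 0 c ^+ 2 by apply: sumr_ge0 => c _; exact: sqr_ge0.
rewrite -(sqr_sqrtr s0) lerXn2r ?nnegrE ?sqrtr_ge0 //.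
apply/rV_normP; first exact: sqrtr_ge0.
move=> c; rewrite -(sqrtr_sqr (u 0 c)) ler_wsqrtr // (bigD1 c) //= lerDl.
by apply: sumr_ge0 => i _; exact: sqr_ge0.
Qed.

Lemma derive_bounded (f df : R -> R) (T : R) : 0 <= T ->
  (forall t, 0 <= t <= T -> is_derive t (1 : R) f (df t)) ->
  exists M, forall t, 0 <= t <= T -> `|f t| <= M.
Proof.
move=> T0 hf.
have fc : {within `[0, T], continuous f}.
  apply: (derivable_within_continuous (i := `[0, T]%R)) => t.
  by rewrite in_itv /= => tT; have [] := hf t tT.
have [a _ ha] := EVT_max T0 fc; have [b _ hb] := EVT_min T0 fc.
exists (`|f a| + `|f b|) => t tT.
have := ha t; have := hb t; rewrite in_itv /= => /(_ tT) h1 /(_ tT) h2.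
have := ler_norm (f a); have := lerNnormlW (lexx `|f b|).
have := normr_ge0 (f a); have := normr_ge0 (f b).
by rewrite ler_norml => *; apply/andP; split; lra.
Qed.

Lemma ode_bounded F x (T : R) : 0 <= T ->
  (forall t, 0 <= t <= T -> ode_at F x t) ->
  exists M, forall t, 0 <= t <= T -> `|x t| <= M.
Proof.
move=> T0 hx.
have bc c : exists M, forall t, 0 <= t <= T -> `|x t 0 c| <= M.
  by apply: (derive_bounded T0 (df := fun t => F (x t) 0 c)) => t /hx.
have [M hM] := choice bc.
have M0 c : 0 <= M c by apply: le_trans (hM c 0 _); rewrite ?lexx.
exists (\sum_c M c) => t tT; apply/rV_normP; first exact: sumr_ge0.
move=> c; apply: le_trans (hM c t tT) _.
by rewrite (bigD1 c) //= lerDl sumr_ge0.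
Qed.

(** Both solutions are bounded on the compact time interval, so one Lipschitz constant serves.
    Gronwall is applied to the squared Euclidean distance, which is differentiable unlike the max
    norm; the factor [m] comes from estimating each coordinate by the whole distance. *)
Lemma ode_unique_forward F x y (T : R) : lipschitz_on_balls F -> 0 <= T ->
  x 0 = y 0 -> (forall t, 0 <= t <= T -> ode_at F x t) ->
  (forall t, 0 <= t <= T -> ode_at F y t) -> x T = y T.
Proof.
move=> Fl T0 xy0 hx hy.
have [Mx hMx] := ode_bounded T0 hx; have [My hMy] := ode_bounded T0 hy.
have [K K0 hK] := Fl (Num.max Mx My).
pose phi t := \sum_c (x t 0 c - y t 0 c) * (x t 0 c - y t 0 c).
have phiE t : phi t = \sum_c (x t - y t) 0 c ^+ 2.
  by apply: eq_bigr => c _; rewrite !mxE expr2.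
pose dphi t := \sum_c
  ((x t 0 c - y t 0 c) * (F (x t) 0 c - F (y t) 0 c) +
   (x t 0 c - y t 0 c) * (F (x t) 0 c - F (y t) 0 c)).
have hphi t : 0 <= t <= T -> is_derive t 1 phi (dphi t).
  move=> tT; apply: derive_pt_sum => c _.
  by have hxt := hx t tT c; have hyt := hy t tT c; apply: derive_ptM.
have : phi T <= phi 0 * expR (2 * K * m%:R * T).
  apply: (gronwall_le T0 hphi) => t tT.
  have dF c : (x t 0 c - y t 0 c) * (F (x t) 0 c - F (y t) 0 c) +
      (x t 0 c - y t 0 c) * (F (x t) 0 c - F (y t) 0 c) <= 2 * K * phi t.
    have h1 : `|F (x t) - F (y t)| <= K * `|x t - y t|.
      by apply: hK; rewrite le_max ?hMx ?hMy ?orbT.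
    have := rV_coord_le (F (x t) - F (y t)) c; rewrite !mxE => h2.
    have := rV_coord_le (x t - y t) c; rewrite !mxE => h3.
    have h4 := rV_norm_sqr_le (x t - y t); rewrite -phiE in h4.
    have : `|(x t 0 c - y t 0 c) * (F (x t) 0 c - F (y t) 0 c)| <= K * phi t.
      rewrite normrM; apply: (@le_trans _ _ (`|x t - y t| * (K * `|x t - y t|))).
        by apply: ler_pM => //; exact: le_trans h2 h1.
      by rewrite mulrCA -expr2 ler_wpM2l // ltW.
    by move=> /(le_trans (ler_norm _)); lra.
  apply: le_trans (ler_sum _ (fun c _ => dF c)) _.
  rewrite sumr_const card_ord -mulr_natr.
  by rewrite le_eqVlt; apply/orP; left; apply/eqP; ring.
have -> : phi 0 = 0 by rewrite /phi big1 // => c _; rewrite xy0 subrr mul0r.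
rewrite mul0r phiE => h; apply/eqP; rewrite -subr_eq0 -normr_eq0 -sqrf_eq0.
by rewrite eq_le sqr_ge0 andbT; exact: le_trans (rV_norm_sqr_le _) h.
Qed.

Lemma lipschitz_on_balls_opp F :
  lipschitz_on_balls F -> lipschitz_on_balls (fun u => - F u).
Proof.
move=> Fl b; have [K K0 hK] := Fl b; exists K => // u v ub vb.
by rewrite -opprD normrN; exact: hK.
Qed.

Lemma ode_at_reverse F x t : ode_at F x (- t) ->
  ode_at (fun u => - F u) (fun s => x (- s)) t.
Proof.
by move=> h c; rewrite mxE; apply: (derive_pt_opp (f := fun s => x s 0 c)).
Qed.

Lemma ode_unique F x y (T : R) : lipschitz_on_balls F -> x 0 = y 0 ->
  (forall t, (0 <= t <= T) || (T <= t <= 0) -> ode_at F x t) ->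
  (forall t, (0 <= t <= T) || (T <= t <= 0) -> ode_at F y t) -> x T = y T.
Proof.
move=> Fl xy0 hx hy; case: (leP 0 T) => [T0|/ltW T0].
  by apply: (ode_unique_forward Fl T0 xy0) => t tT; [apply: hx|apply: hy];
    rewrite tT.
rewrite -[T]opprK.
apply: (@ode_unique_forward (fun u => - F u) (fun s => x (- s))
  (fun s => y (- s))).
- exact: lipschitz_on_balls_opp.
- by rewrite oppr_ge0.
- by rewrite oppr0.
- by move=> t tT; apply: ode_at_reverse; apply: hx; apply/orP; right; lra.
- by move=> t tT; apply: ode_at_reverse; apply: hy; apply/orP; right; lra.
Qed.

(** A continuation argument in discrete steps: during a time [e] the function rises by at most
    [b' - b], so the bound [b] up to [n * e] gives the weak bound [b'] up to [(n + 1) * e], which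
    [step] improves to [b] again. *)
Lemma lipschitz_bootstrap (g : R -> R) (k b b' T : R) :
  (forall t s, `|g t - g s| <= k * `|t - s|) -> b < b' -> g 0 <= b' ->
  (forall t, 0 <= t <= T -> (forall s, 0 <= s <= t -> g s <= b') -> g t <= b) ->
  forall t, 0 <= t <= T -> g t <= b.
Proof.
move=> gl bb g0 step.
pose e := (b' - b) / (`|k| + 1).
have k1 : 0 < `|k| + 1 by rewrite ltr_wpDl.
have e0 : 0 < e by rewrite divr_gt0 // subr_gt0.
have main (n : nat) t : 0 <= t <= T -> t <= n%:R * e -> g t <= b.
  elim: n t => [|n ih] t tT tn.
    apply: step => // s st; have -> : s = 0 by lra.
    by [].
  apply: step => // s st; have [sn|sn] := leP s (n%:R * e).
    by apply: (le_trans _ (ltW bb)); apply: ih => //; lra.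
  have n0 : 0 <= n%:R * e by rewrite mulr_ge0 // ltW.
  have h1 : g (n%:R * e) <= b by apply: ih; lra.
  have := gl s (n%:R * e); rewrite (ger0_norm (x := s - _)); last by lra.
  move=> h2; have h3 : k * (s - n%:R * e) <= (`|k| + 1) * e.
    apply: (@le_trans _ _ ((`|k| + 1) * (s - n%:R * e))).
      by rewrite ler_wpM2r //; [lra|have := ler_norm k; lra].
    rewrite ler_wpM2l ?(ltW k1) //; move: tn; rewrite -natr1 mulrDl mul1r; lra.
  have e1 : (`|k| + 1) * e = b' - b by rewrite /e; field; rewrite gt_eqF.
  have := ler_norm (g s - g (n%:R * e)); lra.
move=> t tT; apply: (main (Num.Def.archi_bound (t / e))) => //.
rewrite -ler_pdivrMr // ltW // archi_boundP // divr_ge0 ?(ltW e0) //.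
by case/andP: tT.
Qed.

(** A retraction onto the ball of the max norm. Acting coordinatewise, it does not increase
    distances in that norm, so composing a field that is Lipschitz on balls with it gives a bounded
    and globally Lipschitz field. *)
Definition clamp (b : R) (u : 'rV[R]_m) : 'rV[R]_m :=
  \row_c Num.max (- b) (Num.min b (u 0 c)).

Lemma clamp_norm b u : 0 <= b -> `|clamp b u| <= b.
Proof.
move=> b0; apply/rV_normP => // c; rewrite mxE ler_norml.
by rewrite le_max lexx /= ge_max ge_min lexx /= andbT; lra.
Qed.

Lemma clamp_lip b u v : `|clamp b u - clamp b v| <= `|u - v|.
Proof.
apply/rV_normP => // c; rewrite !mxE.
have := rV_coord_le (u - v) c; rewrite !mxE => /(le_trans _); apply.
set a := u 0 c; set a' := v 0 c.
have := ler_norm (a - a'); have := ler_norm (a' - a).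
rewrite (distrC a' a) => h1 h2.
rewrite ler_norml !maxEle !minEle.
by case: (leP b a) => c1; case: (leP b a') => c2; case: (leP (- b) b) => c3;
  case: (leP (- b) a) => c4; case: (leP (- b) a') => c5;
  apply/andP; split; lra.
Qed.

Lemma clamp_id b u : `|u| <= b -> clamp b u = u.
Proof.
move=> ub; apply/rowP => c; rewrite mxE.
have := le_trans (rV_coord_le u c) ub; rewrite ler_norml => /andP[h1 h2].
by rewrite (min_idPr h2) (max_idPr h1).
Qed.

Lemma ode_at_lipschitz F y b : (forall u, `|F u| <= b) ->
  (forall t, ode_at F y t) -> forall t s, `|y t - y s| <= b * `|t - s|.
Proof.
move=> Fb hy t s; have b0 : 0 <= b by apply: le_trans (Fb 0).
apply/rV_normP; first by rewrite mulr_ge0.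
move=> c; rewrite !mxE.
apply: (@derive_bound_lipschitz _ (fun t => y t 0 c) (fun t => F (y t) 0 c)).
  by move=> r; exact: hy.
by move=> r; apply: le_trans (rV_coord_le _ _) (Fb _).
Qed.

(* The vector field is cut off outside a large ball; the a priori bound shows
   that the solution of the truncated equation never reaches the cut-off. *)
Theorem ode_global F (x0 : 'rV[R]_m) : lipschitz_on_balls F ->
  (forall T : R, 0 <= T -> exists b, forall z (s t : R), `|s| = 1 ->
     0 <= t <= T -> z 0 = x0 ->
     (forall r, 0 <= r <= t -> ode_at (fun u => s *: F u) z r) -> `|z t| <= b) ->
  exists y, y 0 = x0 /\ forall t, ode_at F y t.
Proof.
move=> Fl apriori.
have local (n : nat) : exists y, y 0 = x0 /\
    forall t : R, `|t| < n.+1%:R -> ode_at F y t.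
  have [b hb] := apriori n.+1%:R (ler0n _ _).
  (* The cut-off radius exceeds both the a priori bound and the initial norm; the extra 1 is the
     margin that the bootstrap needs. *)
  pose B := `|b| + `|x0| + 1.
  have B0 : 0 <= B by rewrite !addr_ge0.
  have [K K0 hK] := Fl B; pose Fc u := F (clamp B u).
  have Fclip u v : `|Fc u - Fc v| <= K * `|u - v|.
    apply: le_trans (hK _ _ (clamp_norm _ B0) (clamp_norm _ B0)) _.
    by rewrite ler_wpM2l ?clamp_lip // ltW.
  have Fcb u : `|Fc u| <= `|Fc 0| + K * (B + B).
    have -> : Fc u = Fc 0 + (Fc u - Fc 0) by rewrite addrC subrK.
    apply: le_trans (ler_normD _ _) _; rewrite lerD2l.
    apply: le_trans (hK _ _ (clamp_norm _ B0) (clamp_norm _ B0)) _.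
    rewrite ler_wpM2l //; first exact: ltW.
    by apply: le_trans (ler_normB _ _) _; rewrite lerD // clamp_norm.
  have Cb0 : 0 <= `|Fc 0| + K * (B + B).
    by rewrite addr_ge0 // mulr_ge0 ?addr_ge0 // ltW.
  have [y [y0 hy]] := picard_global K0 Cb0 Fclip Fcb x0.
  have hyode t : ode_at Fc y t by move=> c; exact: hy.
  have ylip := ode_at_lipschitz Fcb hyode.
  (* The sign [s] is the direction of time: [y (s * t)] follows the field [s *: F] as long as the
     cut-off is inactive. *)
  have bound (s : R) : `|s| = 1 -> forall t, 0 <= t <= n.+1%:R ->
      `|y (s * t)| <= `|b| + `|x0|.
    move=> s1; apply: (@lipschitz_bootstrap (fun t => `|y (s * t)|)
      (`|Fc 0| + K * (B + B)) _ B).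
    - move=> t r; apply: le_trans (ler_dist_dist _ _) _.
      by apply: le_trans (ylip _ _) _; rewrite -mulrBr normrM s1 mul1r.
    - by rewrite /B ltrDl.
    - by rewrite mulr0 y0 /B -addrA addrCA lerDl addr_ge0.
    move=> t tT hB; apply: (@le_trans _ _ b).
      apply: (hb (fun t => y (s * t)) s t) => //; first by rewrite mulr0.
      move=> r rt c; rewrite mxE.
      have -> : F (y (s * r)) = Fc (y (s * r)) by rewrite /Fc clamp_id // hB.
      have h : is_derive r 1 (fun s0 : R => s * s0) (s * 1) by apply: derive_ptZ.
      have := is_derive1_comp (f := fun s => y s 0 c) (hyode (s * r) c) h.
      by rewrite mulr1 mulrC.
    by apply: le_trans (ler_norm _) _; rewrite lerDl.
  exists y; split=> // t /ltW tn c.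
  have -> : F (y t) = Fc (y t); last exact: hy.
  rewrite /Fc clamp_id //; apply: (@le_trans _ _ (`|b| + `|x0|)); last first.
    by rewrite /B lerDl.
  have [t0|t0] := leP 0 t.
    by rewrite -[t]mul1r; apply: bound; rewrite ?normr1 // t0 -(ger0_norm t0).
  rewrite -[t]opprK -mulN1r; apply: bound; rewrite ?normrN ?normr1 //.
  by rewrite oppr_ge0 (ltW t0) /= -(ltr0_norm t0).
have [Y hY] := choice local.
have [n p s sn sp|y hy] := @exhaustion_glue R _ Y.
  apply: (ode_unique Fl).
  - by rewrite (hY n).1 (hY p).1.
  - move=> t ts; apply: (hY n).2; apply: le_lt_trans sn.
    by rewrite ler_norml; have := ler_norm s; have := lerNnormlW (lexx `|s|); lra.
  - move=> t ts; apply: (hY p).2; apply: le_lt_trans sp.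
    by rewrite ler_norml; have := ler_norm s; have := lerNnormlW (lexx `|s|); lra.
exists y; split; first by rewrite (hy 0%N) ?normr0 // (hY 0%N).1.
move=> t c; have [n tn] := exhaustion_near t.
have tn0 : `|t| < n.+1%:R by exact: nbhs_singleton tn.
rewrite (hy n) //; apply: (near_eq_is_derive (f := fun s => Y n s 0 c)).
  by near=> s; rewrite (hy n) //; near: s.
exact: (hY n).2.
Unshelve. all: by end_near. Qed.

End LocallyLipschitzODE.

(** * Linear algebra of rigid motions *)

Section ReducedForm.
Context {R : realType}.

(** Pick [\rank D] independent rows of [D] and change coordinates so that they become the first
    basis vectors. All rows of [D] are combinations of these, so the remaining columns vanish. *)
Lemma reduced_frame (N n : nat) (D : 'M[R]_(N, n)) :
  exists (B : 'M[R]_n) (f : 'I_(\rank D) -> 'I_N), [/\ B \in unitmx,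
    forall l a, (D *m B) (f l) a = (l == a :> nat)%:R &
    forall i (a : 'I_n), (\rank D <= a)%N -> (D *m B) i a = 0].
Proof.
set k := \rank D.
pose C := col_base D; pose P : 'M[R]_(k, n) := pid_mx k.
have kn : (k <= n)%N := rank_leq_col D.
have CF : row_full C := col_base_full D.
pose f := fullrankfun CF; pose H := rowsub f C.
have HU : H \in unitmx by exact: fullrowsub_unit.
have PP : P *m P^T = 1%:M.
  by rewrite /P tr_pid_mx pid_mx_id // pid_mx_1.
(* As [P] is the block row [[1 0]], the matrices [X] and [X'] are block diagonal, with blocks
   [invmx H] and 1, respectively [H] and 1. *)
pose X := 1%:M + P^T *m (invmx H - 1%:M) *m P.
pose X' := 1%:M + P^T *m (H - 1%:M) *m P.
have XX' : X *m X' = 1%:M.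
  pose a := invmx H - 1%:M; pose b := H - 1%:M.
  have ab : P^T *m a *m P *m (P^T *m b *m P) = P^T *m (a *m b) *m P.
    by rewrite -!mulmxA (mulmxA P) PP mul1mx.
  have ab0 : b + (a + a *m b) = 0.
    rewrite /a /b mulmxBl mul1mx mulmxBr mulVmx // mulmx1.
    by apply/matrixP => i j; rewrite !mxE; ring.
  rewrite /X /X' -/a -/b mulmxDl mul1mx mulmxDr mulmx1 ab -addrA -mulmxDl.
  by rewrite -mulmxDr -mulmxDl -mulmxDr ab0 mulmx0 mul0mx addr0.
have PX : P *m X = invmx H *m P.
  rewrite /X mulmxDr mulmx1 !mulmxA PP mul1mx mulmxBl mul1mx.
  by rewrite addrC subrK.
pose B := invmx (row_ebase D) *m X.
have DB : D *m B = C *m (invmx H *m P).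
  rewrite -PX /B !mulmxA; congr (_ *m _).
  have {1}-> : D = C *m P *m row_ebase D.
    by rewrite /C /col_base -(mulmxA (col_ebase D)) pid_mx_id // mulmx_ebase.
  by rewrite mulmxK ?row_ebase_unit.
exists B, f; split.
- by rewrite unitmx_mul unitmx_inv row_ebase_unit (mulmx1_unit XX').1.
- move=> l a; have -> : (D *m B) (f l) a = (rowsub f (D *m B)) l a by rewrite [RHS]mxE.
  rewrite DB -mul_rowsub_mx -/H mulmxA mulmxV // mul1mx mxE.
  by rewrite ltn_ord andbT.
- move=> i a ka; rewrite DB mulmxA mxE big1 // => l _.
  by rewrite [P l a]mxE (_ : (l == a :> nat) = false) ?mulr0 //;
    apply/negbTE; rewrite neq_ltn (leq_trans (ltn_ord l) ka).
Qed.

(** Dimension count: on the row space of [A], whose elements all satisfy [P], reading off the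
    coordinates outside [I] is injective. Since [P] is only a predicate, it can combine several
    conditions without forming a subspace. *)
Lemma rank_restrict_coords (N n s : nat) (A : 'M[R]_(s, N * n)) (B : 'M[R]_n)
    (I : {set 'I_N * 'I_n}) (P : 'M[R]_(N, n) -> Prop) :
  (forall w : 'rV[R]_s, P (vec_mx (w *m A))) ->
  (forall Y, P Y -> (forall c, c \notin I -> (Y *m B) c.1 c.2 = 0) -> Y = 0) ->
  (\rank A <= N * n - #|I|)%N.
Proof.
move=> hA hI.
pose phi (y : 'rV[R]_(N * n)) : 'rV[R]_#|~: I| :=
  \row_c (vec_mx y *m B) (enum_val c).1 (enum_val c).2.
have phi_lin : linear phi.
  move=> c u v; apply/rowP => d; rewrite !mxE linearP mulr_sumr -big_split /=.
  by apply: eq_bigr => i _; rewrite !mxE mulrDl mulrA.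
pose Phi := GRing.isLinear.Build R _ _ _ phi phi_lin.
pose phiL : {linear 'rV[R]_(N * n) -> 'rV[R]_#|~: I|} := HB.pack phi Phi.
have -> : (N * n - #|I|)%N = #|~: I|.
  by rewrite [RHS]cardsCs finset.setCK card_prod !card_ord.
rewrite -(mxrank_mul_ker A (lin1_mx phiL)).
suff -> : (A :&: kermx (lin1_mx phiL))%MS = 0.
  by rewrite mxrank0 addn0 rank_leq_col.
apply/eqP/rowV0P => v; rewrite sub_capmx => /andP[/submxP[w ->] /sub_kermxP].
rewrite mul_rV_lin1 /= => h.
apply: (can_inj vec_mxK); rewrite linear0; apply: hI => // c cI.
have cI' : c \in ~: I by rewrite inE.
have := congr1 (fun u : 'rV_#|~: I| => u 0 (enum_rank_in cI' c)) h.
by rewrite !mxE enum_rankK_in.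
Qed.

End ReducedForm.

Section RigidMotions.
Context {R : realType}.
Variables (N n : nat).
Hypotheses (n_gt0 : (0 < n)%N) (N_ge_n : (n <= N)%N).
Implicit Types (q U Y : 'M[R]_(N, n)).

(* U is orthogonal to the translations and the infinitesimal rotations of q. *)
Definition motion_free q U :=
  (forall a, \sum_i U i a = 0) /\
  (forall a b, \sum_i q i a * U i b = \sum_i q i b * U i a).

Lemma motion_freeD q U V : motion_free q U -> motion_free q V ->
  motion_free q (U + V).
Proof.
move=> [Us Ur] [Vs Vr]; split.
  move=> a; under eq_bigr do rewrite mxE.
  by rewrite big_split /= Us Vs addr0.
move=> a b; under eq_bigr do rewrite mxE mulrDr.
under [RHS]eq_bigr do rewrite mxE mulrDr.
by rewrite !big_split /= Ur Vr.
Qed.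

Lemma motion_freeZ q U c : motion_free q U -> motion_free q (c *: U).
Proof.
move=> [Us Ur]; split.
  move=> a; under eq_bigr do rewrite mxE.
  by rewrite -mulr_sumr Us mulr0.
move=> a b; under eq_bigr do rewrite mxE mulrCA.
under [RHS]eq_bigr do rewrite mxE mulrCA.
by rewrite -!mulr_sumr Ur.
Qed.

(** The terms [b + 1] add up to [n (n + 1) / 2], the dimension of the group of rigid motions. The
    surplus [e] in a single column [b0] is what contradicts the rank for configurations of too small
    affine span. *)
Lemma card_staircase (I : {set 'I_N * 'I_n}) (b0 : 'I_n) (e : nat) :
  (forall b : 'I_n, (b + 1 + (e * (b == b0)) <= #|[set i | (i, b) \in I]%SET|)%N) ->
  ((n * n.+1) %/ 2 + e <= #|I|)%N.
Proof.
move=> h.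
have -> : #|I| = (\sum_(b < n) #|[set i | (i, b) \in I]%SET|)%N.
  rewrite -sum1_card.
  rewrite (eq_bigl (fun c : 'I_N * 'I_n => true && ((c.1, c.2) \in I))); last by case.
  rewrite -(pair_big_dep xpredT (fun i b => (i, b) \in I) (fun _ _ => 1%N)) /=.
  rewrite (exchange_big_dep xpredT) //=.
  by apply: eq_bigr => b _; rewrite -sum1_card; apply: eq_bigl => i; rewrite inE.
apply: leq_trans (leq_sum _ (fun b _ => h b)).
rewrite big_split /=; have -> : (\sum_(b < n) e * (b == b0) = e)%N.
  by rewrite (bigD1 b0) //= eqxx muln1 big1 ?addn0 // => b /negbTE ->; rewrite muln0.
rewrite leq_add2r big_split /= sum1_card card_ord.
rewrite -(big_mkord xpredT (fun b => b)) bin2_sum bin2.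
have : (n * n.+1 = n * n.-1 + n * 2)%N by case: (n) => // k; rewrite /=; lia.
by move=> ->; rewrite addnC divnMDl // divn2 addnC.
Qed.

(** The rank of this matrix is the dimension of the affine span of [q]. *)
Definition displacements q (i0 : 'I_N) : 'M[R]_(N, n) :=
  \matrix_(i, a) (q i a - q i0 a).

(** An affine frame: [i0] is its origin, with number 0, and [f l] has number [l + 1]. Numbers beyond
    [k] default to [i0]. *)
Definition frame_vertex k (i0 : 'I_N) (f : 'I_k -> 'I_N) (a : nat) : 'I_N :=
  if a is a'.+1 then oapp f i0 (insub a' : option 'I_k) else i0.

(** The coordinates usually pinned to remove rigid motions: the origin in every column, and frame
    vertex [a] in the columns from [a] on, since vertex [a] lies along axis [a - 1]. Columns from
    [k'] on are included entirely. *)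
Definition frame_index k (i0 : 'I_N) (f : 'I_k -> 'I_N) (k' : nat) :
    {set 'I_N * 'I_n} :=
  [set c : 'I_N * 'I_n | (c.2 < k')%N ==>
    [exists a : 'I_c.2.+1, c.1 == frame_vertex i0 f a]]%SET.

Section Frame.
Variables (k : nat) (q : 'M[R]_(N, n)) (i0 : 'I_N) (B : 'M[R]_n)
  (f : 'I_k -> 'I_N).
Local Notation D := (displacements q i0).
Hypotheses (k_le_n : (k <= n)%N) (B_unit : B \in unitmx).
Hypothesis DBf : forall l a, (D *m B) (f l) a = (l == a :> nat)%:R.
Hypothesis DB0 : forall i (a : 'I_n), (k <= a)%N -> (D *m B) i a = 0.

Local Notation g := (frame_vertex i0 f).

Let DBg a (l : 'I_n) : (a <= k)%N -> (D *m B) (g a) l = (a == l.+1)%:R.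
Proof.
case: a => [_|a ak]; last by rewrite /= insubT /= DBf.
by rewrite mxE big1 // => i _; rewrite mxE subrr mul0r.
Qed.

Let g_inj a b : (a <= k)%N -> (b <= k)%N -> g a = g b -> a = b.
Proof.
have aux a' b' : (a' < k)%N -> (b' <= k)%N -> g a'.+1 = g b' -> a'.+1 = b'.
  move=> ak bk gab; pose l : 'I_n := Ordinal (leq_trans ak k_le_n).
  have := DBg (a := a'.+1) l ak; rewrite gab DBg // eqxx.
  by case: eqP => [->//|_] /eqP; rewrite eq_sym oner_eq0.
case: a b => [|a] [|b] // ak bk gab; first by rewrite -(aux b 0%N).
all: by apply: aux.
Qed.

Variable k' : nat.
Hypothesis k'_le : (k' <= k.+1)%N.

Local Notation I := (frame_index i0 f k').

(** Orthogonality to rotations says that [D^T *m Y] is symmetric, and this survives applying the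
    same [B] to both factors although [B] need not be orthogonal. In the new coordinates the
    symmetry exchanges pinned entries with entries outside the staircase, which vanish; the row of
    [i0] then vanishes because the column sums do. The bound [k' <= k + 1] ensures that every frame
    vertex used exists. *)
Lemma frame_restriction_injective Y : motion_free q Y ->
  (forall i (b : 'I_n), (k' <= b)%N -> (Y *m B) i b = 0) ->
  (forall c, c \notin I -> (Y *m B) c.1 c.2 = 0) -> Y = 0.
Proof.
move=> [Ysum Ysym] Yk YI; pose Z := Y *m B.
suff Z0 : Z = 0 by rewrite -[Y](mulmxK B_unit) -/Z Z0 mul0mx.
have Zsum b : \sum_i Z i b = 0.
  under eq_bigr do rewrite mxE.
  by rewrite exchange_big big1 // => a _; rewrite -mulr_suml Ysum mul0r.
have DYsym : (D^T *m Y)^T = D^T *m Y.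
  apply/matrixP => a b; rewrite !mxE.
  have E u v : \sum_i D^T u i * Y i v = \sum_i q i u * Y i v.
    under eq_bigr do rewrite !mxE mulrBl.
    rewrite sumrB -mulr_sumr Ysum mulr0 subr0; exact: eq_bigr.
  by rewrite !E Ysym.
have Zsym a b : \sum_i (D *m B) i a * Z i b = \sum_i (D *m B) i b * Z i a.
  have E u v : \sum_i (D *m B) i u * Z i v = ((D *m B)^T *m Z) u v.
    by rewrite mxE; apply: eq_bigr => i _; rewrite [(D *m B)^T _ _]mxE.
  have S : ((D *m B)^T *m Z)^T = (D *m B)^T *m Z.
    have -> : (D *m B)^T *m Z = B^T *m (D^T *m Y) *m B.
      by rewrite /Z trmx_mul !mulmxA.
    move: DYsym; generalize (D^T *m Y) => W WW.
    by rewrite !trmx_mul WW trmxK mulmxA.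
  by rewrite !E -{1}S mxE.
have Zout i (b : 'I_n) : (forall a : nat, (a <= b)%N -> i != g a) -> Z i b = 0.
  move=> h; have [kb|bk] := leqP k' b; first exact: Yk.
  apply: (YI (i, b)); rewrite inE /= bk /=; apply/existsP => -[a] /=.
  by apply/negP/h; rewrite -ltnS.
have Sg (l b : 'I_n) : (l < k)%N -> (b < k')%N ->
    \sum_i (D *m B) i l * Z i b = Z (g l.+1) b.
  move=> lk bk; have [v vE] : exists v, v = g l.+1 by exists (g l.+1).
  rewrite -vE (bigD1 v) //= vE DBg // -vE eqxx mul1r big1 ?addr0 // => i il.
  have [[a ab ia]|h] := pselect (exists2 a : nat, (a <= b)%N & i = g a); last first.
    by rewrite Zout ?mulr0 // => a ab; apply/eqP => ia; apply: h; exists a.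
  have ak : (a <= k)%N by lia.
  rewrite ia DBg //; case: eqP => [al|_]; last by rewrite mul0r.
  by move: il; rewrite ia al vE eqxx.
(* With [a = l + 1], symmetry turns this entry into the one of vertex [g b.+1] in column [l < b],
   outside the staircase. If [b >= k], column [b] of [D *m B] vanishes and no such vertex is
   needed. *)
have Zg0 (a b : nat) (hb : (b < n)%N) : (0 < a <= b)%N -> (b < k')%N ->
    Z (g a) (Ordinal hb) = 0.
  case: a => // l /= lb bk.
  have lk : (l < k)%N by lia.
  have ln : (l < n)%N by lia.
  rewrite -(Sg (Ordinal ln)) // Zsym.
  have [kb|kb] := leqP k b; first by rewrite big1 // => i _; rewrite DB0 // mul0r.
  rewrite (Sg (Ordinal hb)) //; last by apply: leq_trans (ltn_trans lb bk).
  apply: Zout => a al; have {}al : (a <= l)%N := al; apply/eqP => /g_inj H.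
  by have bE : nat_of_ord (Ordinal hb) = b := erefl; move: H; rewrite bE; lia.
apply/matrixP => i b; rewrite [RHS]mxE.
have [kb|bk] := leqP k' b; first exact: Yk.
have Zpos (a : nat) : (0 < a <= b)%N -> Z (g a) b = 0.
  by case: b bk => b hb bk ab; exact: Zg0.
have Zi j : j != i0 -> Z j b = 0.
  move=> ji; have [[a ab ja]|h] := pselect (exists2 a : nat, (a <= b)%N & j = g a).
    rewrite ja; apply: Zpos; rewrite ab andbT lt0n; apply/eqP => a0.
    by move: ji; rewrite ja a0 /= eqxx.
  by apply: Zout => a ab; apply/eqP => ia; apply: h; exists a.
have [->|] := eqVneq i i0; last exact: Zi.
have := Zsum b; rewrite (bigD1 i0) //= big1 ?addr0 // => j; exact: Zi.
Qed.

Lemma frame_restriction_card (b : 'I_n) :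
  #|[set i | (i, b) \in I]%SET| = if (b < k')%N then b.+1 else N.
Proof.
case: ifP => bk.
  have -> : [set i | (i, b) \in I]%SET = [set g a | a : 'I_b.+1]%SET.
    apply/setP => i; rewrite !finset.in_set /= bk /=.
    apply/existsP/imsetP => [[a /eqP ->]|[a _ ->]]; exists a => //=.
  rewrite card_imset ?card_ord // => a a' /g_inj H; apply: val_inj; apply: H => /=.
    by have := ltn_ord a; lia.
  by have := ltn_ord a'; lia.
rewrite -[RHS]card_ord -cardsT; congr #|pred_of_set _|.
by apply/setP => i; rewrite !finset.in_set /= bk.
Qed.

End Frame.

(* E is the rigidity matrix of q up to row scaling; its rows are motion_free.  If
   q affinely spans at least a hyperplane, restricting to the complement of a
   staircase of coordinates shows that the motion_free vectors have dimension at
   most the rank of E, hence form its row space.  Otherwise the rows of E also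
   vanish in some directions, and a larger staircase contradicts the rank. *)
Theorem rigid_motion_free_eq0 (s : nat) (E : 'M[R]_(s, N * n)) q U :
  (forall k, exists i j (c : R), forall l a, vec_mx (row k E) l a =
     c * ((l == i)%:R - (l == j)%:R) * (q i a - q j a)) ->
  \rank E = (n * N - (n * n.+1) %/ 2)%N ->
  motion_free q U -> E *m (mxvec U)^T = 0 -> U = 0.
Proof.
move=> hE rE mU EU.
have i0 : 'I_N by apply: (Ordinal (leq_trans n_gt0 N_ge_n)).
pose D := displacements q i0.
have [B [f [BU DBf DB0]]] := reduced_frame D.
set k := \rank D in f DBf DB0 *.
have kn : (k <= n)%N := rank_leq_col D.
have ind i j (F : 'I_N -> R) :
    \sum_l ((l == i)%:R - (l == j)%:R) * F l = F i - F j.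
  under eq_bigr do rewrite mulrBl.
  rewrite sumrB (bigD1 i) //= big1 ?addr0; last by move=> l /negbTE ->; rewrite mul0r.
  rewrite (bigD1 j) //= big1 ?addr0; last by move=> l /negbTE ->; rewrite mul0r.
  by rewrite !eqxx !mul1r.
have row_mf w : motion_free q (vec_mx (w *m E)).
  have -> : vec_mx (w *m E) = \sum_l w 0 l *: vec_mx (row l E).
    by rewrite mulmx_sum_row linear_sum; apply: eq_bigr => l _; rewrite linearZ.
  split.
    move=> a; under eq_bigr do rewrite summxE.
    rewrite exchange_big big1 //= => l _; have [i [j [c hl]]] := hE l.
    rewrite -[RHS](subrr (w 0 l * (c * (q i a - q j a)))).
    rewrite -(ind i j (fun=> w 0 l * (c * (q i a - q j a)))).
    by apply: eq_bigr => l0 _; rewrite mxE hl; ring.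
  have key a b : \sum_i q i a * (\sum_l w 0 l *: vec_mx (row l E)) i b =
    \sum_l w 0 l * \sum_i q i a * vec_mx (row l E) i b.
    under eq_bigr do rewrite summxE mulr_sumr.
    rewrite exchange_big; apply: eq_bigr => l _; rewrite mulr_sumr.
    by apply: eq_bigr => i _; rewrite mxE mulrCA.
  move=> a b; rewrite !key; apply: eq_bigr => l _; congr (_ * _).
  have [i [j [c hl]]] := hE l.
  have S u v : \sum_l0 q l0 u * vec_mx (row l E) l0 v =
      c * (q i u - q j u) * (q i v - q j v).
    transitivity (c * (q i v - q j v) * (q i u - q j u)); last by ring.
    rewrite -(ind i j (fun l0 => q l0 u)) mulr_sumr.
    by apply: eq_bigr => l0 _; rewrite hl; ring.
  by rewrite !S; ring.
have row_k w i (b : 'I_n) : (k <= b)%N -> (vec_mx (w *m E) *m B) i b = 0.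
  move=> kb.
  have -> : vec_mx (w *m E) = \sum_l w 0 l *: vec_mx (row l E).
    by rewrite mulmx_sum_row linear_sum; apply: eq_bigr => l _; rewrite linearZ.
  rewrite mulmx_suml summxE big1 // => l _; rewrite -scalemxAl mxE.
  have [i' [j [c hl]]] := hE l; rewrite mxE.
  under eq_bigr do rewrite hl.
  have -> : \sum_a c * ((i == i')%:R - (i == j)%:R) * (q i' a - q j a) * B a b =
    c * ((i == i')%:R - (i == j)%:R) * ((D *m B) i' b - (D *m B) j b).
    rewrite !mxE -sumrB mulr_sumr; apply: eq_bigr => a _.
    by rewrite !mxE; ring.
  by rewrite !DB0 // subrr !mulr0.
have NG : (n * n.+1 %/ 2 <= n * N)%N.
  apply: (@leq_trans ((n * N * 2) %/ 2)); last by rewrite mulnK.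
  by apply: leq_div2r; nia.
have inj' (k' : nat) := @frame_restriction_injective k q i0 B f kn BU DBf DB0 k'.
have card' (k' : nat) := @frame_restriction_card k q i0 B f kn BU DBf k'.
have [nk|kn1] := leqP n k.+1.
  (* Appending [U] to the rows of [E] cannot raise the rank, so [U] lies in the row space of [E]; it
     is also orthogonal to that space, hence zero. *)
  pose A := col_mx E (mxvec U).
  have rA : (\rank A <= \rank E)%N.
    rewrite rE (mulnC n N).
    apply: (@leq_trans (N * n - #|frame_index i0 f n|)).
      apply: (rank_restrict_coords (B := B) (P := motion_free q)).
        move=> w; rewrite -[w]hsubmxK mul_row_col linearD /=.
        apply: motion_freeD => //.
        have -> : rsubmx w *m mxvec U = rsubmx w 0 0 *: mxvec U.
          by rewrite {1}[rsubmx w]mx11_scalar mul_scalar_mx.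
        by rewrite linearZ /= mxvecK; exact: motion_freeZ.
      move=> Y mY YI; apply: (inj' n nk) => // i b nb.
      by have := leq_trans (ltn_ord b) nb; rewrite ltnn.
    apply: leq_sub2l; rewrite -[leqLHS]addn0.
    apply: (@card_staircase _ (Ordinal n_gt0)) => b.
    by rewrite (card' n nk) ltn_ord mul0n addn0 addn1.
  have EA : (E <= A)%MS by rewrite -addsmxE addsmxSl.
  have UE : (mxvec U <= E)%MS.
    apply: (@submx_trans _ _ _ _ _ _ A); first by rewrite -addsmxE addsmxSr.
    by rewrite -(mxrank_leqif_sup EA) eqn_leq rA mxrankS.
  have [w wE] := submxP UE.
  have UU : mxvec U *m (mxvec U)^T = 0 by rewrite {1}wE -mulmxA EU mulmx0.
  apply: (can_inj mxvecK); rewrite linear0; apply/rowP => c; rewrite [RHS]mxE.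
  have := congr1 (fun M : 'M[R]_(1, 1) => M 0 0) UU; rewrite mxE [RHS]mxE => /eqP.
  rewrite psumr_eq0; last by move=> i _; rewrite [(mxvec U)^T _ _]mxE -expr2 sqr_ge0.
  move=> /allP /(_ c (mem_index_enum c)); rewrite [(mxvec U)^T _ _]mxE -expr2 sqrf_eq0.
  by move/eqP.
(* Now [k <= n - 2], so column [n - 2] is included entirely: it has [N >= n] entries where the
   staircase asks for [n - 1], a surplus of at least one. *)
have n1 : (n - 2 < n)%N by lia.
have : (\rank E <= N * n - #|frame_index i0 f k|)%N.
  apply: (rank_restrict_coords (B := B) (P := fun Y => motion_free q Y /\
    forall i (b : 'I_n), (k <= b)%N -> (Y *m B) i b = 0)).
    by move=> w; split=> //; exact: row_k.
  by move=> Y [mY Yk] YI; apply: (inj' k _).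
have := @card_staircase (frame_index i0 f k) (Ordinal n1) 1%N.
have h (b : 'I_n) : (b + 1 + 1 * (b == Ordinal n1) <= #|[set i | (i, b) \in frame_index i0 f k]%SET|)%N.
  rewrite card' //; case: ifP => bk.
    have -> : (b == Ordinal n1) = false.
      by apply/negP => /eqP bE; move: bk; rewrite bE /=; lia.
    by rewrite muln0 addn0 addn1.
  case: eqP => [->|_] /=; last by have := ltn_ord b; lia.
  lia.
move=> /(_ h); rewrite rE (mulnC N n).
have mc : (#|frame_index i0 f k| <= N * n)%N.
  by apply: leq_trans (max_card _) _; rewrite card_prod !card_ord.
move: NG mc; rewrite (mulnC n N).
set X := (N * n)%N; set Y := (n * n.+1 %/ 2)%N; lia.
Qed.

End RigidMotions.

(** * Edge sums and the local gradient inequality *)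

Section FiniteSums.
Context {R : realType}.

Lemma cauchy_schwarz_sum (I : finType) (P : pred I) (x y : I -> R) :
  (\sum_(i | P i) x i * y i) ^+ 2 <=
  (\sum_(i | P i) x i ^+ 2) * (\sum_(i | P i) y i ^+ 2).
Proof.
set X := \sum_(i | P i) x i ^+ 2; set Y := \sum_(i | P i) y i ^+ 2.
set Z := \sum_(i | P i) x i * y i.
have X0 : 0 <= X by apply: sumr_ge0 => i _; exact: sqr_ge0.
have [X00|Xn0] := eqVneq X 0.
  have x0 i : P i -> x i = 0.
    move=> Pi; apply/eqP; rewrite -sqrf_eq0.
    have /eqP := X00; rewrite psumr_eq0 => [/allP/(_ i (mem_index_enum i))|j _].
      by rewrite Pi.
    exact: sqr_ge0.
  by rewrite X00 mul0r /Z big1 ?expr0n // => i Pi; rewrite x0 // mul0r.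
have Xp : 0 < X by rewrite lt_def Xn0.
have : 0 <= \sum_(i | P i) (Z * x i - X * y i) ^+ 2.
  by apply: sumr_ge0 => i _; exact: sqr_ge0.
have -> : \sum_(i | P i) (Z * x i - X * y i) ^+ 2 = X * (X * Y - Z ^+ 2).
  transitivity (\sum_(i | P i) (Z ^+ 2 * x i ^+ 2 +
      (- (2 * (Z * X)) * (x i * y i) + X ^+ 2 * y i ^+ 2))).
    by apply: eq_bigr => i _; ring.
  by rewrite !big_split -!mulr_sumr -/X -/Y -/Z /=; ring.
by rewrite pmulr_rge0 // subr_ge0.
Qed.

End FiniteSums.

Section FrameworkAlgebra.
Context {R : realType}.
Variables (N n : nat) (G : {set {set 'I_N}}) (d : {set 'I_N} -> R).
Implicit Types P Q U : 'M[R]_(N, n).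

Definition adj (i j : 'I_N) : bool := [set i; j]%SET \in G.

Lemma adjC i j : adj i j = adj j i.
Proof. by rewrite /adj finset.setUC. Qed.

(* Every edge is counted twice. *)
Definition edge_sum (F : 'I_N -> 'I_N -> R) : R := \sum_i \sum_(j | adj i j) F i j.

Lemma edge_sumC F : edge_sum F = edge_sum (fun i j => F j i).
Proof.
rewrite /edge_sum (exchange_big_dep xpredT) //=; apply: eq_bigr => i _.
by apply: eq_bigl => j; rewrite adjC.
Qed.

Lemma eq_edge_sum F H : (forall i j, adj i j -> F i j = H i j) -> edge_sum F = edge_sum H.
Proof. by move=> FH; apply: eq_bigr => i _; apply: eq_bigr => j; exact: FH. Qed.

Lemma edge_sumD F H : edge_sum (fun i j => F i j + H i j) = edge_sum F + edge_sum H.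
Proof. by rewrite /edge_sum -big_split /=; apply: eq_bigr => i _; rewrite big_split. Qed.

Lemma edge_sumZ c F : edge_sum (fun i j => c * F i j) = c * edge_sum F.
Proof. by rewrite /edge_sum mulr_sumr; apply: eq_bigr => i _; rewrite mulr_sumr. Qed.

Lemma le_edge_sum F H : (forall i j, adj i j -> F i j <= H i j) -> edge_sum F <= edge_sum H.
Proof. by move=> FH; apply: ler_sum => i _; apply: ler_sum => j; exact: FH. Qed.

Lemma edge_sum_ge0 F : (forall i j, adj i j -> 0 <= F i j) -> 0 <= edge_sum F.
Proof. by move=> F0; apply: sumr_ge0 => i _; apply: sumr_ge0 => j; exact: F0. Qed.

Lemma edge_sum_le_cst F c : 0 <= c -> (forall i j, adj i j -> F i j <= c) ->
  edge_sum F <= N%:R ^+ 2 * c.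
Proof.
move=> c0 Fc; apply: (@le_trans _ _ (\sum_(i < N) \sum_(j < N) c)).
  apply: ler_sum => i _; rewrite [leRHS](bigID (adj i)) /=.
  rewrite -[leLHS]addr0 lerD //; first by apply: ler_sum => j; exact: Fc.
  by rewrite sumr_ge0.
by rewrite !sumr_const !card_ord -mulrnA -[leLHS]mulr_natl natrM expr2.
Qed.

Lemma edge_sum_term_le F i j : (forall i j, adj i j -> 0 <= F i j) -> adj i j ->
  F i j <= edge_sum F.
Proof.
move=> F0 aij; rewrite /edge_sum (bigD1 i) //= (bigD1 j) //= -addrA lerDl.
rewrite addr_ge0 //; first by apply: sumr_ge0 => k /andP[+ _]; exact: F0.
by apply: sumr_ge0 => k _; apply: sumr_ge0 => l; exact: F0.
Qed.

(** Half the derivative of [sqdist] at [P] in the direction [U]; its vanishing on all edges means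
    that [U] is in the kernel of the derivative of the edge map. *)
Definition edot P U i j : R := \sum_a (P i a - P j a) * (U i a - U j a).
Definition sqdist P i j : R := edot P P i j.
Definition err P i j : R := sqdist P i j - d [set i; j]%SET ^+ 2.
Definition dot P U : R := \sum_i \sum_a P i a * U i a.
Definition grad P : 'M[R]_(N, n) :=
  \matrix_(i, a) \sum_(j | adj i j) err P i j * (P i a - P j a).
(** The factor is [8^-1] instead of [4^-1] because [edge_sum] counts each edge twice. *)
Definition pot P : R := 8^-1 * edge_sum (fun i j => err P i j ^+ 2).

Lemma edotC P U i j : edot P U i j = edot P U j i.
Proof. by apply: eq_bigr => a _; ring. Qed.

Lemma errC P i j : err P i j = err P j i.
Proof. by rewrite /err /sqdist edotC finset.setUC. Qed.

Lemma sqd_ge0 P i j : 0 <= sqdist P i j.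
Proof. by apply: sumr_ge0 => a _; rewrite -expr2 sqr_ge0. Qed.

Lemma dot_ge0 P : 0 <= dot P P.
Proof. by do 2!apply: sumr_ge0 => ? _; rewrite -expr2 sqr_ge0. Qed.

Lemma pot_ge0 P : 0 <= pot P.
Proof. by rewrite mulr_ge0 // edge_sum_ge0 // => i j _; exact: sqr_ge0. Qed.

Lemma edge_sum_err P : edge_sum (fun i j => err P i j ^+ 2) = 8 * pot P.
Proof. by rewrite /pot mulVKf ?pnatr_eq0. Qed.

(** Summation by parts: averaging over the two orientations of an edge replaces [U i] by
    [U i - U j]. *)
Lemma dot_grad P U :
  dot U (grad P) = 2^-1 * edge_sum (fun i j => err P i j * edot P U i j).
Proof.
pose H i j := err P i j * \sum_a (P i a - P j a) * U i a.
have -> : dot U (grad P) = edge_sum H.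
  apply: eq_bigr => i _; rewrite /H.
  transitivity (\sum_a \sum_(j | adj i j) err P i j * ((P i a - P j a) * U i a)).
    apply: eq_bigr => a _; rewrite mxE mulr_sumr.
    by apply: eq_bigr => j _; ring.
  by rewrite exchange_big; apply: eq_bigr => j _; rewrite mulr_sumr.
have -> : edge_sum (fun i j => err P i j * edot P U i j) = edge_sum H + edge_sum H.
  rewrite {2}(edge_sumC H) -edge_sumD; apply: eq_edge_sum => i j _; rewrite /H (errC P j i).
  rewrite -mulrDr; congr (_ * _); rewrite -big_split /=.
  by apply: eq_bigr => a _; ring.
by field.
Qed.

Lemma row_sqr_le U i : \sum_a U i a ^+ 2 <= dot U U.
Proof.
rewrite /dot (bigD1 i) //=; under [X in _ <= X + _]eq_bigr do rewrite -expr2.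
by rewrite lerDl; do 2!apply: sumr_ge0 => ? _; rewrite -expr2 sqr_ge0.
Qed.

Lemma sqd_le_dot U i j : sqdist U i j <= 4 * dot U U.
Proof.
have h : sqdist U i j <= \sum_a (2 * U i a ^+ 2 + 2 * U j a ^+ 2).
  by apply: ler_sum => a _; have := sqr_ge0 (U i a + U j a); nra.
apply: (le_trans h); rewrite big_split /= -!mulr_sumr.
by have := row_sqr_le U i; have := row_sqr_le U j; lra.
Qed.

Lemma err_expand P Q i j : sqdist Q i j = d [set i; j]%SET ^+ 2 ->
  err P i j = 2 * edot Q (P - Q) i j + sqdist (P - Q) i j.
Proof.
rewrite /err => <-; rewrite /sqdist /edot -sumrB mulr_sumr -big_split /=.
by apply: eq_bigr => a _; rewrite !mxE; ring.
Qed.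

(** Write [U = P - Q]. The edge map is quadratic, so [err P] is exactly [2 * edot Q U + sqdist U] on
    edges. The smallness hypothesis makes the quadratic part harmless: it costs at most a third of
    [pot P] in the pairing of [U] with the gradient. *)
Lemma lojasiewicz_local (c : R) P Q : 0 < c ->
  (forall i j, adj i j -> sqdist Q i j = d [set i; j]%SET ^+ 2) ->
  c * dot (P - Q) (P - Q) <= edge_sum (fun i j => edot Q (P - Q) i j ^+ 2) ->
  32 * N%:R ^+ 2 * dot (P - Q) (P - Q) <= c ->
  pot P <= 16 / c * dot (grad P) (grad P).
Proof.
move=> c0 QS hc hd; set U := P - Q in hc hd *; set f := dot U U in hc hd *.
have f0 : 0 <= f by exact: dot_ge0.
have exp i j : adj i j -> err P i j = 2 * edot Q U i j + sqdist U i j.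
  by move=> aij; apply: err_expand; exact: QS.
have W : edge_sum (fun i j => sqdist U i j ^+ 2) <= 16 * N%:R ^+ 2 * f ^+ 2.
  apply: le_trans (edge_sum_le_cst (c := 16 * f ^+ 2) _ _) _.
  - by rewrite mulr_ge0 // sqr_ge0.
  - move=> i j _; have := sqd_le_dot U i j; have := sqd_ge0 U i j; rewrite -/f.
    by nra.
  - by rewrite le_eqVlt; apply/orP; left; apply/eqP; ring.
have E := edge_sum_err P.
have L4 : 4 * edge_sum (fun i j => edot Q U i j ^+ 2) <=
    2 * edge_sum (fun i j => err P i j ^+ 2) + 2 * edge_sum (fun i j => sqdist U i j ^+ 2).
  rewrite -!edge_sumZ -edge_sumD; apply: le_edge_sum => i j aij; rewrite exp //.
  have := sqr_ge0 (2 * edot Q U i j + 2 * sqdist U i j); nra.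
have Nf : 32 * N%:R ^+ 2 * f ^+ 2 <= c * f.
  by rewrite [f ^+ 2]expr2 mulrA ler_wpM2r.
have fV : 3 * (c * f) <= 16 * pot P by lra.
have UG : 2 / 3 * pot P <= dot U (grad P).
  rewrite dot_grad.
  have -> : edge_sum (fun i j => err P i j * edot P U i j) =
    2^-1 * edge_sum (fun i j => err P i j ^+ 2) +
    2^-1 * edge_sum (fun i j => err P i j * sqdist U i j).
    rewrite -!edge_sumZ -edge_sumD; apply: eq_edge_sum => i j aij.
    have -> : edot P U i j = edot Q U i j + sqdist U i j.
      rewrite /sqdist /edot -big_split /=; apply: eq_bigr => a _.
      by rewrite !mxE; ring.
    have -> : edot Q U i j = 2^-1 * (err P i j - sqdist U i j) by rewrite exp //; field.
    by field.
  have : - (2^-1 * edge_sum (fun i j => err P i j ^+ 2) +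
      2^-1 * edge_sum (fun i j => sqdist U i j ^+ 2)) <=
      edge_sum (fun i j => err P i j * sqdist U i j).
    rewrite lerNl -!edge_sumZ -edge_sumD -[leLHS]mulN1r -edge_sumZ.
    by apply: le_edge_sum => i j _; have := sqr_ge0 (err P i j + sqdist U i j); nra.
  by rewrite E; lra.
(* The weight [c / 32] is small enough that, by [fV], the term in [f] takes at most [pot P / 6] from
   the [2 / 3 * pot P] of [UG], leaving one half. *)
have young : dot U (grad P) <= c / 32 * f + 8 / c * dot (grad P) (grad P).
  rewrite /f /dot !mulr_sumr -big_split /=; apply: ler_sum => i _.
  rewrite !mulr_sumr -big_split /=; apply: ler_sum => a _.
  have := sqr_ge0 (c / 16 * U i a - grad P i a).
  have -> : (c / 16 * U i a - grad P i a) ^+ 2 =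
    (c / 8) * (c / 32 * (U i a * U i a) + 8 / c * (grad P i a * grad P i a)
      - U i a * grad P i a) by field; rewrite gt_eqF.
  by rewrite pmulr_rge0 ?divr_gt0 // subr_ge0.
have -> : 16 / c = 2 * (8 / c) by rewrite mulrA; congr (_ / _); ring.
rewrite -mulrA; set X := 8 / c * _ in young *.
have : c / 32 * f <= 6^-1 * pot P by rewrite mulrAC; lra.
lra.
Qed.

Variable dm : R.
Hypothesis d_le : forall i j, adj i j -> d [set i; j]%SET ^+ 2 <= dm.

Lemma err_le P i j : pot P <= 1 -> adj i j -> `|err P i j| <= 3.
Proof.
move=> V1 aij.
have : err P i j ^+ 2 <= 8.
  have := edge_sum_term_le (F := fun i j => err P i j ^+ 2)
    (fun i j _ => sqr_ge0 (err P i j)) aij.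
  by rewrite /= edge_sum_err; lra.
by move=> h; rewrite ler_norml; apply/andP; split; nra.
Qed.

Lemma sqd_le P i j : pot P <= 1 -> adj i j -> sqdist P i j <= dm + 3.
Proof.
move=> V1 aij; have := err_le V1 aij; have := d_le aij.
by rewrite ler_norml /err => h /andP[h1 h2]; lra.
Qed.

(** Converse of the gradient inequality: it makes the cross term of the Lyapunov function comparable
    with the energy. Edge lengths are bounded on a sublevel set even though positions are not. *)
Lemma grad_sqr_le P : 0 <= dm -> pot P <= 1 ->
  dot (grad P) (grad P) <= 8 * N%:R * (dm + 3) * pot P.
Proof.
move=> dm0 V1.
have -> : 8 * N%:R * (dm + 3) * pot P = (N%:R * (dm + 3)) * edge_sum (fun i j => err P i j ^+ 2).
  by rewrite edge_sum_err; ring.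
rewrite /dot /edge_sum mulr_sumr; apply: ler_sum => i _.
apply: (@le_trans _ _ (\sum_a (\sum_(j | adj i j) err P i j ^+ 2) *
   (\sum_(j | adj i j) (P i a - P j a) ^+ 2))).
  by apply: ler_sum => a _; rewrite -expr2 mxE; exact: cauchy_schwarz_sum.
rewrite -mulr_sumr mulrC ler_wpM2r //; first by apply: sumr_ge0 => j _; exact: sqr_ge0.
rewrite exchange_big /=; apply: (@le_trans _ _ (\sum_(j < N | adj i j) (dm + 3))).
  apply: ler_sum => j aij; apply: le_trans (sqd_le V1 aij).
  by apply: ler_sum => a _; rewrite expr2.
rewrite sumr_const -[leLHS]mulr_natl ler_wpM2r //; first lra.
by rewrite ler_nat; apply: leq_trans (max_card _) _; rewrite card_ord.
Qed.

Definition hess P U : 'M[R]_(N, n) := \matrix_(i, a) \sum_(j | adj i j)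
  (err P i j * (U i a - U j a) + (P i a - P j a) * (2 * edot P U i j)).

(** The quadratic form of the Hessian appears in the derivative of the cross term, where only an
    upper bound matters. Symmetrising over edge orientations gives half the sum of
    [err * sqdist U + 2 * edot ^+ 2]. *)
Lemma hess_form_le P U : 0 <= dm -> pot P <= 1 ->
  dot U (hess P U) <= 4 * N%:R ^+ 2 * (dm + 5) * dot U U.
Proof.
move=> dm0 V1.
pose H i j := err P i j * \sum_a (U i a - U j a) * U i a +
   2 * edot P U i j * \sum_a (P i a - P j a) * U i a.
have E1 : dot U (hess P U) = edge_sum H.
  apply: eq_bigr => i _; rewrite /H.
  transitivity (\sum_a \sum_(j | adj i j) (err P i j * ((U i a - U j a) * U i a) +
     2 * edot P U i j * ((P i a - P j a) * U i a))).
    apply: eq_bigr => a _; rewrite mxE mulr_sumr.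
    by apply: eq_bigr => j _; ring.
  rewrite exchange_big; apply: eq_bigr => j _; rewrite !mulr_sumr.
  by rewrite -big_split.
have E2 : edge_sum (fun i j => err P i j * sqdist U i j + 2 * edot P U i j ^+ 2) =
    edge_sum H + edge_sum H.
  rewrite {2}(edge_sumC H) -edge_sumD; apply: eq_edge_sum => i j _; rewrite /H (errC P j i).
  rewrite (edotC P U j i).
  have <- : \sum_a (U i a - U j a) * U i a + \sum_a (U j a - U i a) * U j a = sqdist U i j.
    by rewrite -big_split; apply: eq_bigr => a _ /=; ring.
  have e2 : \sum_a (P i a - P j a) * U i a + \sum_a (P j a - P i a) * U j a = edot P U i j.
    by rewrite -big_split; apply: eq_bigr => a _ /=; ring.
  by rewrite expr2 -{2}e2; ring.
have : edge_sum (fun i j => err P i j * sqdist U i j + 2 * edot P U i j ^+ 2) <=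
    N%:R ^+ 2 * ((2 * dm + 9) * (4 * dot U U)).
  have f0 := dot_ge0 U.
  apply: edge_sum_le_cst; first by rewrite !mulr_ge0 //; lra.
  move=> i j aij; have := err_le V1 aij; rewrite ler_norml => /andP[_ e3].
  have CS : edot P U i j ^+ 2 <= sqdist P i j * sqdist U i j.
    apply: le_trans (cauchy_schwarz_sum _ _ _) _.
    by rewrite le_eqVlt; apply/orP; left; apply/eqP; congr (_ * _);
      apply: eq_bigr => a _; rewrite expr2.
  have s3 := sqd_le V1 aij; have w0 := sqd_ge0 U i j; have w4 := sqd_le_dot U i j.
  apply: (@le_trans _ _ ((2 * dm + 9) * sqdist U i j)); last first.
    by rewrite ler_wpM2l //; lra.
  nra.
rewrite E2 E1 => h.
have : 0 <= N%:R ^+ 2 * dot U U by rewrite mulr_ge0 ?sqr_ge0 ?dot_ge0.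
lra.
Qed.

End FrameworkAlgebra.

(** * The edge map and the potential in coordinates *)

Section DefinitionsInCoordinates.
Context {R : realType}.
Variables (N n : nat) (G : {set {set 'I_N}}) (d : {set 'I_N} -> R).
Hypothesis G_edges : forall e : {set 'I_N}, e \in G -> #|e| = 2%N.
Hypothesis d_gt0 : forall e : {set 'I_N}, e \in G -> 0 < d e.
Implicit Types p : 'rV[R]_(N * n).

Lemma adj_neq i j : adj G i j -> i != j.
Proof.
by move=> /G_edges; apply: contra_eq_neq => ->; rewrite finset.setUid cards1.
Qed.

Lemma enorm_sqr k (u : 'rV[R]_k) : enorm u ^+ 2 = \sum_c u 0 c ^+ 2.
Proof. by rewrite sqr_sqrtr // sumr_ge0 // => c _; exact: sqr_ge0. Qed.

Lemma enorm_block p i j : enorm (block p j - block p i) ^+ 2 = sqdist (vec_mx p) i j.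
Proof. by rewrite enorm_sqr; apply: eq_bigr => a _; rewrite !mxE; ring. Qed.

Lemma edge_pairs_sum (F : 'I_N -> 'I_N -> R) : (forall i j, F i j = F j i) ->
  \sum_(ij in edge_pairs G) F ij.1 ij.2 = 2^-1 * edge_sum G F.
Proof.
move=> FC; pose S := \sum_i \sum_(j | adj G i j && (i < j)%N) F i j.
have -> : \sum_(ij in edge_pairs G) F ij.1 ij.2 = S.
  rewrite /S (pair_big_dep xpredT (fun i j => adj G i j && (i < j)%N)) /=.
  by apply: eq_bigl => -[i j]; rewrite finset.in_set /= andbC.
have -> : edge_sum G F = S + S.
  rewrite /edge_sum /S.
  transitivity (\sum_i \sum_(j | adj G i j && (i < j)%N) F i j +
                \sum_i \sum_(j | adj G i j && ~~ (i < j)%N) F i j).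
    by rewrite -big_split /=; apply: eq_bigr => i _; rewrite -bigID.
  congr (_ + _); rewrite (exchange_big_dep xpredT) //=; apply: eq_bigr => i _.
  apply: eq_big => [j|j _]; last exact: FC.
  rewrite adjC; case aij: (adj G i j) => //=.
  by have := adj_neq aij; rewrite -leqNgt leq_eqVlt (inj_eq val_inj) => /negbTE ->.
by field.
Qed.

Lemma potentialE p : potential G d p = pot G d (vec_mx p).
Proof.
rewrite /potential /pot.
rewrite (eq_bigr (fun ij : 'I_N * 'I_N => err d (vec_mx p) ij.1 ij.2 ^+ 2)).
  by rewrite (edge_pairs_sum (F := fun i j => err d (vec_mx p) i j ^+ 2));
    [field | move=> i j; rewrite errC].
by move=> ij _; rewrite enorm_block.
Qed.

Lemma desired_formationsP p : desired_formations G d p <->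
  forall i j, adj G i j -> sqdist (vec_mx p) i j = d [set i; j]%SET ^+ 2.
Proof.
split=> h i j aij; first by rewrite -enorm_block h.
apply/eqP; rewrite -(@eqrXn2 _ 2) //; first by rewrite enorm_block h.
  exact: sqrtr_ge0.
by rewrite ltW // d_gt0.
Qed.

Lemma is_derive_coord m (p e : 'rV[R]_m) c :
  is_derive p e (fun q : 'rV[R]_m => q 0 c) (e 0 c).
Proof.
have h : derivable (id : 'rV[R]_m -> 'rV[R]_m) p e by exact: derivable_id.
have := (derivable_mxP id p e).1 h 0 c => h2; apply: DeriveDef => //.
by have := derive_mx h; rewrite derive_id => /rowP/(_ c); rewrite [RHS]mxE.
Qed.

Lemma is_derive_vec_mx p e i (a : 'I_n) :
  is_derive p e (fun q => vec_mx q i a) (vec_mx e i a).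
Proof.
have -> : (fun q : 'rV[R]_(N * n) => vec_mx q i a) = (fun q => q 0 (mxvec_index i a)).
  by apply/funext => q; rewrite mxE.
by rewrite mxE; exact: is_derive_coord.
Qed.

Lemma is_derive_sqd p e i j :
  is_derive p e (fun q => sqdist (vec_mx q) i j) (2 * edot (vec_mx p) (vec_mx e) i j).
Proof.
rewrite /edot mulr_sumr; apply: derive_pt_sum => a _.
have hi := is_derive_vec_mx p e i a; have hj := is_derive_vec_mx p e j a.
apply: (is_derive_eq (derive_ptM (derive_ptB hi hj) (derive_ptB hi hj))).
by ring.
Qed.

(** Edges away from [i] do not depend on [p_i], so the gradient of [V_i] in [p_i] is the block of
    the gradient of the total potential. This turns the decentralised control into a damped gradient
    system. *)
Lemma block_gradientE p i :
  block_gradient i (local_potential G d i) p = row i (grad G d (vec_mx p)).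
Proof.
apply/rowP => a; rewrite mxE [RHS]mxE [RHS]mxE; apply: (@derive_val _ _ _ _ _ _ _ _).
pose e : 'rV[R]_(N * n) := mxvec (delta_mx i a).
have he k b : vec_mx e k b = ((k == i) && (b == a))%:R by rewrite mxvecK mxE.
have -> : local_potential G d i = (fun q : 'rV[R]_(N * n) =>
    4^-1 * \sum_(j < N | adj G i j) err d (vec_mx q) i j * err d (vec_mx q) i j).
  apply/funext => q; rewrite /local_potential; congr (_ * _).
  by apply: eq_bigr => j _; rewrite enorm_block expr2.
have hs j : is_derive p e (fun q => err d (vec_mx q) i j)
    (2 * edot (vec_mx p) (vec_mx e) i j).
  rewrite -[2 * _]subr0; apply: derive_ptB; exact: is_derive_sqd.
apply: (is_derive_eq (derive_ptZ 4^-1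
  (derive_pt_sum (fun j (_ : adj G i j) => derive_ptM (hs j) (hs j))))).
rewrite mulr_sumr; apply: eq_bigr => j aij.
have -> : edot (vec_mx p) (vec_mx e) i j = vec_mx p i a - vec_mx p j a.
  rewrite /edot (bigD1 a) //= !he !eqxx /= big1; last first.
    by move=> b /negbTE ba; rewrite !he ba !andbF subrr mulr0.
  by rewrite (eq_sym j) (negbTE (adj_neq aij)) /= addr0 subr0 mulr1.
by field.
Qed.

Definition rigidity_mx p : 'M[R]_(N * n, #|edge_pairs G|) :=
  \matrix_(c, k) (2 * edot (vec_mx p) (vec_mx (delta_mx 0 c))
     (enum_val k).2 (enum_val k).1).

Lemma mul_rigidity_mx p (u : 'rV[R]_(N * n)) k : (u *m rigidity_mx p) 0 k =
  2 * edot (vec_mx p) (vec_mx u) (enum_val k).2 (enum_val k).1.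
Proof.
rewrite mxE /edot; set i := (enum_val k).2; set j := (enum_val k).1.
transitivity (\sum_c u 0 c * (2 * edot (vec_mx p) (vec_mx (delta_mx 0 c)) i j)).
  by apply: eq_bigr => c _; rewrite mxE.
rewrite mulr_sumr; transitivity (\sum_c \sum_a 2 * ((vec_mx p i a - vec_mx p j a) *
  (u 0 c * (vec_mx (delta_mx 0 c : 'rV_(N * n)) i a - vec_mx (delta_mx 0 c : 'rV_(N * n)) j a)))).
  by apply: eq_bigr => c _; rewrite /edot !mulr_sumr; apply: eq_bigr => a _; ring.
rewrite exchange_big; apply: eq_bigr => a _; rewrite -mulr_sumr; congr (_ * _).
rewrite -mulr_sumr; congr (_ * _).
rewrite [in RHS](row_sum_delta u) linear_sum !summxE -sumrB.
by apply: eq_bigr => c _; rewrite linearZ !mxE mulrBr.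
Qed.

(** The remainder of the linear approximation is exactly the edge map of the increment, which is
    quadratic. *)
Lemma jacobian_edge_map p : 'J (@edge_map R N n G) p = rigidity_mx p.
Proof.
pose df (u : 'rV[R]_(N * n)) := u *m rigidity_mx p.
have dfl : linear df by move=> c u v; rewrite /df mulmxDl -scalemxAl.
pose dfB := GRing.isLinear.Build R _ _ _ df dfl.
pose dfL : {linear 'rV[R]_(N * n) -> 'rV[R]_#|edge_pairs G|} := HB.pack df dfB.
have quad (u : 'rV[R]_(N * n)) : (@edge_map R N n G) (u + p) - edge_map G p - df u =
    \row_k sqdist (vec_mx u) (enum_val k).2 (enum_val k).1.
  apply/rowP => k; have := mul_rigidity_mx p u k; rewrite /df.
  generalize (u *m rigidity_mx p) => w hk; rewrite !mxE hk.
  rewrite !enorm_block /sqdist /edot mulr_sumr -!sumrB; apply: eq_bigr => a _.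
  by rewrite linearD !mxE; ring.
suff E : 'd (@edge_map R N n G) p = dfL :> (_ -> _).
  apply/row_matrixP => c; rewrite !rowE /jacobian mul_rV_lin1.
  by rewrite E.
apply: diff_unique.
  pose c := \sum_i \sum_k `|rigidity_mx p i k|.
  have c0 : 0 <= c by do 2!apply: sumr_ge0 => ? _.
  apply: (@lipschitz_continuous _ _ _ _ c) => u v; rewrite -linearB /=.
  move: (u - v) => {u v} u; apply/rV_normP; first by rewrite mulr_ge0.
  move=> k; rewrite mxE; apply: le_trans (ler_norm_sum _ _ _) _.
  rewrite /c mulr_suml; apply: ler_sum => i _; rewrite normrM mulrC.
  apply: ler_pM => //; last exact: rV_coord_le.
  by rewrite (bigD1 k) //= lerDl sumr_ge0.
(* Each of the [n] coordinate differences is at most [2 * |u|] in the max norm, so the remainder is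
   at most [4 * n * |u|^2]; the added 1 keeps the constant positive. *)
have n4 : 0 < 4 * (n%:R : R) + 1 by rewrite ltr_wpDl // mulr_ge0.
apply/eqaddoP => e e0; near=> u.
have -> : (edge_map G \o shift p - (cst (edge_map G p) + dfL)) u =
    (@edge_map R N n G) (u + p) - edge_map G p - df u.
  by rewrite -[LHS]/(edge_map G (u + p) - (edge_map G p + df u)) opprD addrA.
rewrite quad /=; apply/rV_normP; first by rewrite mulr_ge0 // ltW.
move=> k; rewrite mxE ger0_norm ?sqd_ge0 //.
apply: (@le_trans _ _ (\sum_(a < n) 4 * `|u| * `|u|)).
  apply: ler_sum => a _; apply: (le_trans (ler_norm _)); rewrite normrM.
  have h : `|vec_mx u (enum_val k).2 a - vec_mx u (enum_val k).1 a| <= 2 * `|u|.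
    apply: (le_trans (ler_normB _ _)); rewrite !mxE.
    have h1 := rV_coord_le u (mxvec_index (enum_val k).2 a).
    have h2 := rV_coord_le u (mxvec_index (enum_val k).1 a).
    lra.
  have -> : 4 * `|u| * `|u| = (2 * `|u|) * (2 * `|u|) by ring.
  by apply: ler_pM.
rewrite -mulr_suml ler_wpM2r // sumr_const card_ord -[leLHS]mulr_natr -mulrA mulrCA.
apply: (@le_trans _ _ (`|u| * (4 * n%:R + 1))).
  by rewrite ler_wpM2l // lerDl.
rewrite -ler_pdivlMr // ltW //; near: u.
exact: (@cvgr0_norm_lt _ _ _ (nbhs (0 : 'rV[R]_(N * n))) _ id cvg_id _ (divr_gt0 e0 n4)).
Unshelve. all: by end_near. Qed.

Lemma rigid_motion_free p (U : 'M[R]_(N, n)) : (0 < n)%N -> (n <= N)%N ->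
  infinitesimally_rigid G p -> motion_free (vec_mx p) U ->
  (forall i j, adj G i j -> edot (vec_mx p) U i j = 0) -> U = 0.
Proof.
rewrite /infinitesimally_rigid jacobian_edge_map => n0 nN rk mU eU.
apply: (rigid_motion_free_eq0 n0 nN (E := (rigidity_mx p)^T) _ _ mU).
- move=> k; exists (enum_val k).2, (enum_val k).1, 2 => l a.
  rewrite mxE [LHS]mxE [LHS]mxE [LHS]mxE vec_mx_delta.
  set i := (enum_val k).2; set j := (enum_val k).1.
  rewrite /edot (bigD1 a) //= big1 ?addr0; last first.
    by move=> b /negbTE ba; rewrite !mxE ba !andbF subrr mulr0.
  by rewrite ![delta_mx _ _ _ _]mxE eqxx !andbT (eq_sym i) (eq_sym j); ring.
- by rewrite mxrank_tr.
apply: (can_inj trmxK); rewrite trmx_mul trmxK trmxK trmx0.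
apply/rowP => k; rewrite mul_rigidity_mx mxvecK mxE.
rewrite edotC eU ?mulr0 //.
by have := enum_valP k; rewrite finset.in_set => /andP[].
Qed.

End DefinitionsInCoordinates.

(** * Compactness modulo translations *)

Section ContinuityClosure.
Context {R : realType} {T : topologicalType}.
Implicit Types f g : T -> R.

Lemma contD f g : continuous f -> continuous g -> continuous (fun x => f x + g x).
Proof. by move=> hf hg x; apply: cvgD; [exact: hf|exact: hg]. Qed.

Lemma contB f g : continuous f -> continuous g -> continuous (fun x => f x - g x).
Proof. by move=> hf hg x; apply: cvgB; [exact: hf|exact: hg]. Qed.

Lemma contM f g : continuous f -> continuous g -> continuous (fun x => f x * g x).
Proof. by move=> hf hg x; apply: cvgM; [exact: hf|exact: hg]. Qed.

Lemma contX2 f : continuous f -> continuous (fun x => f x ^+ 2).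
Proof. by move=> hf; exact: contM. Qed.

Lemma contC (c : R) : continuous (fun _ : T => c).
Proof. by move=> x; exact: cvg_cst. Qed.

Lemma cont_sum (I : finType) (P : pred I) (f : I -> T -> R) :
  (forall i, P i -> continuous (f i)) -> continuous (fun x => \sum_(i | P i) f i x).
Proof.
move=> hf; have -> : (fun x => \sum_(i | P i) f i x) = \sum_(i | P i) f i.
  by apply/funext => y; rewrite fct_sumE.
elim/big_ind : _ => // [|u v hu hv]; first exact: contC.
exact: contD.
Qed.

Lemma closed_sublevel f (c : R) : continuous f -> closed [set x | f x <= c].
Proof.
move=> hf; apply: (@closed_comp _ _ f [set y | y <= c]); last exact: closed_le.
by move=> x _; exact: hf.
Qed.

Lemma closed_forall (I : Type) (A : I -> set T) : (forall i, closed (A i)) ->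
  closed [set x | forall i, A i x].
Proof.
move=> hA; have -> : [set x | forall i, A i x] = \bigcap_i A i.
  by apply/seteqP; split=> x h i //; exact: h.
by apply: closed_bigI.
Qed.

End ContinuityClosure.

Section Compactness.
Context {R : realType} {m : nat}.

Lemma compact_argmin (A : set 'rV[R]_m) (h : 'rV[R]_m -> R) (b : R) :
  closed A -> (forall x, A x -> `|x| <= b) -> A !=set0 -> continuous h ->
  exists2 x, A x & forall y, A y -> h x <= h y.
Proof.
move=> cA bA A0 hc.
have bdA : bounded_set A.
  exists b; split; first exact: num_real.
  by move=> c bc x /bA xb; exact: le_trans xb (ltW bc).
have cpt : compact A by exact: bounded_closed_compact.
have [x xA hx] := EVT_min_rV A0 cpt (continuous_subspaceT hc).
exists x; first by rewrite inE in xA.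
by move=> y yA; apply: hx; rewrite inE.
Qed.

Lemma compact_lower_bound (A : set 'rV[R]_m) (h : 'rV[R]_m -> R) (b : R) :
  closed A -> (forall x, A x -> `|x| <= b) -> continuous h ->
  (forall x, A x -> 0 < h x) -> exists2 c, 0 < c & forall x, A x -> c <= h x.
Proof.
move=> cA bA hc h0; have [A0|A0] := pselect (A !=set0).
  by have [x xA hx] := compact_argmin cA bA A0 hc; exists (h x) => //; exact: h0.
by exists 1 => // x xA; case: A0; exists x.
Qed.

End Compactness.

Section ContinuousConfigurations.
Context {R : realType} {T : topologicalType}.
Variables (N n : nat) (G : {set {set 'I_N}}) (d : {set 'I_N} -> R).

Definition cont_mx (P : T -> 'M[R]_(N, n)) := forall i a, continuous (fun x => P x i a).

Lemma cont_mxB P U : cont_mx P -> cont_mx U -> cont_mx (fun x => P x - U x).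
Proof.
move=> hP hU i a; rewrite (_ : (fun x => _) = (fun x => P x i a - U x i a)).
  exact: contB.
by apply/funext => x; rewrite !mxE.
Qed.

Lemma cont_edot P U i j : cont_mx P -> cont_mx U ->
  continuous (fun x => edot (P x) (U x) i j).
Proof. by move=> hP hU; apply: cont_sum => a _; apply: contM; exact: contB. Qed.

Lemma cont_dot P U : cont_mx P -> cont_mx U ->
  continuous (fun x => dot (P x) (U x)).
Proof.
by move=> hP hU; apply: cont_sum => i _; apply: cont_sum => a _; exact: contM.
Qed.

Lemma cont_edge_sum (F : T -> 'I_N -> 'I_N -> R) :
  (forall i j, continuous (fun x => F x i j)) -> continuous (fun x => edge_sum G (F x)).
Proof. by move=> hF; apply: cont_sum => i _; exact: cont_sum. Qed.

Lemma cont_pot P : cont_mx P -> continuous (fun x => pot G d (P x)).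
Proof.
move=> hP; apply: contM; first exact: contC.
apply: cont_edge_sum => i j; apply: contX2; apply: contB; last exact: contC.
exact: cont_edot.
Qed.

End ContinuousConfigurations.

Lemma cont_vec_mx (R : realType) N n : cont_mx (fun p : 'rV[R]_(N * n) => vec_mx p).
Proof.
move=> i a; rewrite (_ : (fun x => _) = (fun p : 'rV[R]_(N * n) => p 0 (mxvec_index i a))).
  exact: coord_continuous.
by apply/funext => p; rewrite mxE.
Qed.

Lemma norm_le_dot (R : realType) N n (p : 'rV[R]_(N * n)) (c : R) :
  dot (vec_mx p) (vec_mx p) <= c -> `|p| <= c + 1.
Proof.
move=> pc; have c0 : 0 <= c by apply: le_trans pc; exact: dot_ge0.
apply/rV_normP; first by rewrite addr_ge0.
move=> k; case/mxvec_indexP: k => i a.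
have h : vec_mx p i a ^+ 2 <= c.
  apply: le_trans pc; apply: le_trans (row_sqr_le (vec_mx p) i).
  by rewrite (bigD1 a) //= lerDl sumr_ge0 // => b _; exact: sqr_ge0.
rewrite mxE in h; move: h; set x := p 0 _ => h.
by rewrite ler_norml; apply/andP; split; nra.
Qed.

Section RigidFrameworks.
Context {R : realType}.
Variables (N n : nat) (G : {set {set 'I_N}}) (d : {set 'I_N} -> R).
Implicit Types P Q U : 'M[R]_(N, n).

Definition formation Q := forall i j, adj G i j -> sqdist Q i j = d [set i; j]%SET ^+ 2.

Hypothesis n_gt0 : (0 < n)%N.
Variable i0 : 'I_N.
Hypothesis formation_ex : exists Q, formation Q.
Hypothesis rigid : forall Q U, formation Q -> motion_free Q U ->
  (forall i j, adj G i j -> edot Q U i j = 0) -> U = 0.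

(** A single inequality on a continuous function, in the form that [closed_sublevel] accepts. *)
Lemma formation_pot Q : formation Q <-> pot G d Q <= 0.
Proof.
split=> [hQ|hQ i j aij].
  rewrite /pot (_ : edge_sum _ _ = 0) ?mulr0 //.
  rewrite /edge_sum big1 // => i _; rewrite big1 // => j aij.
  by rewrite /err hQ // subrr expr0n.
have := edge_sum_term_le (F := fun i j => err d Q i j ^+ 2)
  (fun i j _ => sqr_ge0 (err d Q i j)) aij.
rewrite /= edge_sum_err => h; have h0 : err d Q i j ^+ 2 <= 0 by lra.
have : err d Q i j ^+ 2 == 0 by rewrite eq_le h0 sqr_ge0.
by rewrite sqrf_eq0 subr_eq0 => /eqP.
Qed.

(* A function constant along the edges is centred and multiplied by a vector
   chosen so that the product is an infinitesimal motion orthogonal to the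
   trivial ones. *)
Lemma rigid_connected (x : 'I_N -> R) : (forall i j, adj G i j -> x i = x j) ->
  forall i j, x i = x j.
Proof.
move=> hx; have [Q hQ] := formation_ex.
have N0 : (N%:R : R) != 0 by rewrite pnatr_eq0; case: (N) i0 => // -[].
pose y i := x i - (\sum_k x k) / N%:R.
have ysum : \sum_i y i = 0.
  by rewrite sumrB sumr_const card_ord -[X in _ - X]mulr_natr divfK // subrr.
suff y0 i : y i = 0 by move=> i j; have := y0 i; have := y0 j; rewrite /y; lra.
pose be a := \sum_k Q k a * y k.
(* The product [y k * b a] is orthogonal to the rotations of [Q] when [be a * b a'] is symmetric in
   [a] and [a']: take [b = be], or any nonzero vector if [be] vanishes. *)
have [b [a0 ba0] hb] : exists2 b : 'I_n -> R, exists a, b a != 0 &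
    forall a a', be a * b a' = be a' * b a.
  have [[a ha]|h] := pselect (exists a, be a != 0).
    by exists be; [exists a|move=> *; exact: mulrC].
  exists (fun=> 1); first by exists (Ordinal n_gt0); exact: oner_neq0.
  have be0 a : be a = 0 by apply/eqP/negPn/negP => ha; apply: h; exists a.
  by move=> a a'; rewrite !be0.
pose U : 'M[R]_(N, n) := \matrix_(k, a) (y k * b a).
have U0 : U = 0.
  apply: (rigid hQ).
    split=> [a|a a'].
      by under eq_bigr do rewrite mxE; rewrite -mulr_suml ysum mul0r.
    transitivity (be a * b a'); first by
      rewrite /be mulr_suml; apply: eq_bigr => k _; rewrite mxE mulrA.
    by rewrite hb /be mulr_suml; apply: eq_bigr => k _; rewrite mxE mulrA.
  move=> k l akl; rewrite /edot big1 // => a _; rewrite !mxE /y (hx _ _ akl).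
  by rewrite subrr mulr0.
have := congr1 (fun M : 'M[R]_(N, n) => M i a0) U0; rewrite !mxE => /eqP.
by rewrite mulf_eq0 (negbTE ba0) orbF => /eqP.
Qed.

(** On a sublevel set the edges have bounded length, so boundedness of a vertex passes to its
    neighbours. The indicator of the bounded vertices is constant along edges, hence constant, and
    it is 1 at the pinned vertex [i0]. *)
Lemma sublevel_bounded : exists2 b, 0 <= b & forall P,
  (forall a, P i0 a = 0) -> pot G d P <= 1 -> dot P P <= b.
Proof.
pose B i := exists b, forall P, (forall a, P i0 a = 0) -> pot G d P <= 1 ->
  \sum_a P i a ^+ 2 <= b.
have Bstep i j : adj G i j -> B i -> B j.
  move=> aij [b hb].
  exists (2 * b + 2 * (d [set i; j]%SET ^+ 2 + 3)) => P P0 V1.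
  have h1 := hb P P0 V1.
  have := err_le V1 aij; rewrite ler_norml /err => /andP[_ h2].
  apply: (@le_trans _ _ (2 * (\sum_a P i a ^+ 2) + 2 * sqdist P i j)); last by lra.
  rewrite /sqdist /edot !mulr_sumr -big_split; apply: ler_sum => a _ /=.
  by have := sqr_ge0 (2 * P i a - P j a); nra.
have Ball i : B i.
  pose x i : R := if `[< B i >] then 1 else 0.
  have x0 : x i0 = 1.
    rewrite /x asboolT //; exists 0 => P P0 _.
    by rewrite big1 // => a _; rewrite P0 expr0n.
  have := @rigid_connected x; rewrite -[B i]/(B i) => H.
  have : x i = x i0.
    apply: H => k l akl; rewrite /x; case: asboolP => bk; case: asboolP => bl //.
      by case: bl; exact: Bstep bk.
    by case: bk; apply: Bstep bl; rewrite adjC.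
  rewrite x0 /x; case: asboolP => // _ /eqP; by rewrite eq_sym oner_eq0.
have [b hb] := choice Ball.
exists (\sum_i `|b i|); first by rewrite sumr_ge0.
move=> P P0 V1; apply: ler_sum => i _; under eq_bigr do rewrite -expr2.
exact: le_trans (hb i P P0 V1) (ler_norm _).
Qed.

Definition recenter P : 'M[R]_(N, n) := \matrix_(i, a) (P i a - P i0 a).

Lemma edot_recenterl P U i j : edot (recenter P) U i j = edot P U i j.
Proof. by apply: eq_bigr => a _; rewrite !mxE; ring. Qed.

Lemma edot_sym P U i j : edot P U i j = edot U P i j.
Proof. by apply: eq_bigr => a _; rewrite mulrC. Qed.

Lemma sqd_recenter P i j : sqdist (recenter P) i j = sqdist P i j.
Proof. by rewrite /sqdist edot_recenterl edot_sym edot_recenterl. Qed.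

Lemma pot_recenter P : pot G d (recenter P) = pot G d P.
Proof.
by rewrite /pot; congr (_ * _); apply: eq_edge_sum => i j _; rewrite /err sqd_recenter.
Qed.

Lemma recenter_base P a : recenter P i0 a = 0.
Proof. by rewrite mxE subrr. Qed.

Lemma formation_recenter Q : formation Q -> formation (recenter Q).
Proof. by move=> hQ i j aij; rewrite sqd_recenter hQ. Qed.

Lemma motion_free_recenter Q U : motion_free Q U -> motion_free (recenter Q) U.
Proof.
move=> [hs hr]; split=> // a b.
have E u v : \sum_i recenter Q i u * U i v = \sum_i Q i u * U i v.
  under eq_bigr do rewrite mxE mulrBl.
  by rewrite sumrB -mulr_sumr hs mulr0 subr0; exact: eq_bigr.
by rewrite !E.
Qed.

(** A sum of squares that expresses [motion_free] as a closed condition on the pair. *)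
Definition motion_defect Q U : R := \sum_a (\sum_i U i a) ^+ 2 +
  \sum_a \sum_b (\sum_i Q i a * U i b - \sum_i Q i b * U i a) ^+ 2.

Lemma motion_defectP Q U : motion_free Q U <-> motion_defect Q U <= 0.
Proof.
have h1 : 0 <= \sum_a (\sum_i U i a) ^+ 2.
  by apply: sumr_ge0 => a _; exact: sqr_ge0.
have h2 : 0 <= \sum_a \sum_b (\sum_i Q i a * U i b - \sum_i Q i b * U i a) ^+ 2.
  by do 2!apply: sumr_ge0 => ? _; exact: sqr_ge0.
split=> [[hs hr]|h].
  rewrite /motion_defect big1 ?add0r; last by move=> a _; rewrite hs expr0n.
  by rewrite big1 // => a _; rewrite big1 // => b _; rewrite hr subrr expr0n.
split=> [a|a b].
  have /eqP : \sum_a (\sum_i U i a) ^+ 2 = 0.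
    by apply/eqP; rewrite eq_le h1 andbT; move: h; rewrite /motion_defect; lra.
  rewrite psumr_eq0 => [/allP/(_ a (mem_index_enum a))|? _]; last exact: sqr_ge0.
  by rewrite sqrf_eq0 => /eqP.
have /eqP : \sum_a \sum_b (\sum_i Q i a * U i b - \sum_i Q i b * U i a) ^+ 2 = 0.
  by apply/eqP; rewrite eq_le h2 andbT; move: h; rewrite /motion_defect; lra.
rewrite psumr_eq0 => [/allP/(_ a (mem_index_enum a))/eqP/eqP|? _]; last first.
  by apply: sumr_ge0 => ? _; exact: sqr_ge0.
rewrite /= psumr_eq0 => [/allP/(_ b (mem_index_enum b))|? _]; last exact: sqr_ge0.
by rewrite sqrf_eq0 subr_eq0 => /eqP.
Qed.

Lemma dotZ c U : dot (c *: U) (c *: U) = c ^+ 2 * dot U U.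
Proof.
rewrite /dot mulr_sumr; apply: eq_bigr => i _; rewrite mulr_sumr.
by apply: eq_bigr => a _; rewrite !mxE; ring.
Qed.

Lemma edotZ c Q U i j : edot Q (c *: U) i j = c * edot Q U i j.
Proof. by rewrite /edot mulr_sumr; apply: eq_bigr => a _; rewrite !mxE; ring. Qed.

(** The edge sum is positive on the compact set of pairs with [Q] a formation pinned at [i0] and [U]
    a motion-free vector of norm 1. Translation invariance in [Q] and homogeneity in [U] extend its
    minimum to all pairs. *)
Lemma rigidity_constant : exists2 c, 0 < c & forall Q U, formation Q ->
  motion_free Q U -> c * dot U U <= edge_sum G (fun i j => edot Q U i j ^+ 2).
Proof.
have [b b0 hb] := sublevel_bounded.
pose q (x : 'rV[R]_(N * n + N * n)) : 'M[R]_(N, n) := vec_mx (lsubmx x).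
pose u (x : 'rV[R]_(N * n + N * n)) : 'M[R]_(N, n) := vec_mx (rsubmx x).
have cq : cont_mx q.
  move=> i a; rewrite (_ : (fun x => _) = (fun x : 'rV[R]_(N * n + N * n) =>
    x 0 (lshift _ (mxvec_index i a)))); first exact: coord_continuous.
  by apply/funext => p; rewrite !mxE.
have cu : cont_mx u.
  move=> i a; rewrite (_ : (fun x => _) = (fun x : 'rV[R]_(N * n + N * n) =>
    x 0 (rshift _ (mxvec_index i a)))); first exact: coord_continuous.
  by apply/funext => p; rewrite !mxE.
pose A := [set x | pot G d (q x) <= 0] `&` ([set x | \sum_a q x i0 a ^+ 2 <= 0] `&`
  ([set x | (dot (u x) (u x) - 1) ^+ 2 <= 0] `&` [set x | motion_defect (q x) (u x) <= 0])).
have cA : closed A.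
  apply: closedI; last (apply: closedI; last apply: closedI).
  - by apply: closed_sublevel; exact: cont_pot.
  - by apply: closed_sublevel; apply: cont_sum => a _; apply: contX2; exact: cq.
  - apply: closed_sublevel; apply: contX2; apply: contB; last exact: contC.
    exact: cont_dot.
  - apply: closed_sublevel; apply: contD.
      by apply: cont_sum => a _; apply: contX2; apply: cont_sum => i _; exact: cu.
    apply: cont_sum => a _; apply: cont_sum => c _; apply: contX2.
    by apply: contB; apply: cont_sum => i _; apply: contM; [exact: cq|exact: cu
      |exact: cq|exact: cu].
have Aprop x : A x -> [/\ formation (q x), forall a, q x i0 a = 0,
    dot (u x) (u x) = 1 & motion_free (q x) (u x)].
  move=> [/formation_pot hq] [hq0] [hu /motion_defectP hm]; split=> //.
    move=> a; apply/eqP; rewrite -sqrf_eq0 eq_le sqr_ge0 andbT.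
    apply: le_trans hq0; rewrite (bigD1 a) //= lerDl.
    by apply: sumr_ge0 => ? _; exact: sqr_ge0.
  apply/eqP; rewrite -subr_eq0 -sqrf_eq0 eq_le sqr_ge0 andbT.
  exact: hu.
have bA x : A x -> `|x| <= b + 1 + 2.
  move=> /Aprop[hq hq0 hu hm].
  have h1 : `|lsubmx x| <= b + 1.
    apply: norm_le_dot; apply: hb => //.
    by apply: le_trans ler01; exact/formation_pot.
  have h2 : `|rsubmx x| <= 1 + 1 by apply: norm_le_dot; rewrite -/(u x) hu.
  apply/rV_normP; first by rewrite !addr_ge0.
  move=> k; rewrite -(splitK k); case: (fintype.split k) => l /=.
    by have := rV_coord_le (lsubmx x) l; rewrite mxE; lra.
  by have := rV_coord_le (rsubmx x) l; rewrite mxE; lra.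
have hc : continuous (fun x => edge_sum G (fun i j => edot (q x) (u x) i j ^+ 2)).
  by apply: cont_edge_sum => i j; apply: contX2; exact: cont_edot.
have [|c c0 hcA] := compact_lower_bound cA bA hc.
  move=> x /Aprop[hq _ hu hm]; rewrite lt_def edge_sum_ge0 ?andbT; last first.
    by move=> i j _; exact: sqr_ge0.
  apply/negP => /eqP e0; have : u x = 0.
    apply: (rigid hq hm) => i j aij; apply/eqP; rewrite -sqrf_eq0 eq_le sqr_ge0 andbT.
    rewrite -e0; exact: (edge_sum_term_le (F := fun i j => edot (q x) (u x) i j ^+ 2)
      (fun i j _ => sqr_ge0 _) aij).
  move=> ux; move: hu; rewrite ux /dot big1 => [/eqP|i _].
    by rewrite eq_sym oner_eq0.
  by rewrite big1 // => a _; rewrite mxE mul0r.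
exists c => // Q U hQ hm.
have [U0|Un0] := eqVneq (dot U U) 0.
  by rewrite U0 mulr0 edge_sum_ge0 // => i j _; exact: sqr_ge0.
have Up : 0 < dot U U by rewrite lt_def Un0 dot_ge0.
pose s := (Num.sqrt (dot U U))^-1.
have s2 : s ^+ 2 = (dot U U)^-1 by rewrite exprVn sqr_sqrtr // ltW.
pose x := row_mx (mxvec (recenter Q)) (mxvec (s *: U)).
have qx : q x = recenter Q by rewrite /q row_mxKl mxvecK.
have ux : u x = s *: U by rewrite /u row_mxKr mxvecK.
have Ax : A x.
  split; first by rewrite /= qx; apply/formation_pot; exact: formation_recenter.
  split; first by rewrite /= qx big1 // => a _; rewrite recenter_base expr0n.
  split; first by rewrite /= ux dotZ s2 mulVf // subrr expr0n.
  rewrite /= qx ux; apply/motion_defectP; apply: motion_freeZ.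
  exact: motion_free_recenter.
have := hcA x Ax; rewrite qx ux.
have -> : edge_sum G (fun i j => edot (recenter Q) (s *: U) i j ^+ 2) =
    (dot U U)^-1 * edge_sum G (fun i j => edot Q U i j ^+ 2).
  rewrite -s2 -edge_sumZ; apply: eq_edge_sum => i j _.
  by rewrite edot_recenterl edotZ exprMn.
by rewrite mulrC ler_pdivlMr.
Qed.

End RigidFrameworks.

(** * Nearest formations and the uniform gradient inequality *)

Section NearestFormation.
Context {R : realType}.
Variables (N n : nat) (G : {set {set 'I_N}}) (d : {set 'I_N} -> R).
Implicit Types P Q U : 'M[R]_(N, n).

Definition shift_col (a : 'I_n) (s : R) Q : 'M[R]_(N, n) :=
  \matrix_(i, e) (Q i e + (e == a)%:R * s).

Definition plane_rotation (a b : 'I_n) (c s : R) Q : 'M[R]_(N, n) :=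
  \matrix_(i, e) (if e == a then c * Q i a - s * Q i b
                  else if e == b then s * Q i a + c * Q i b else Q i e).

Lemma formation_shift a s Q : formation G d Q -> formation G d (shift_col a s Q).
Proof.
move=> hQ i j aij; rewrite -hQ //; apply: eq_bigr => e _; rewrite !mxE.
by rewrite opprD addrACA subrr addr0.
Qed.

Lemma sum_diff2 (x y : 'I_n -> R) (a b : 'I_n) : a != b ->
  (forall e, e != a -> e != b -> x e = y e) ->
  \sum_e x e - \sum_e y e = (x a + x b) - (y a + y b).
Proof.
move=> ab h; rewrite -sumrB (bigD1 a) //= (bigD1 b) 1?eq_sym //= big1.
  by ring.
by move=> e /andP[ea eb]; rewrite h // subrr.
Qed.

Lemma formation_rotation a b c s Q : a != b -> c ^+ 2 + s ^+ 2 = 1 ->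
  formation G d Q -> formation G d (plane_rotation a b c s Q).
Proof.
move=> ab cs hQ i j aij; rewrite -hQ //; apply/eqP; rewrite -subr_eq0.
rewrite /sqdist /edot (sum_diff2 ab); last first.
  by move=> e ea eb; rewrite !mxE (negbTE ea) (negbTE eb).
rewrite !mxE !eqxx (eq_sym b) (negbTE ab).
set A := Q i a - Q j a; set B := Q i b - Q j b.
have -> : c * Q i a - s * Q i b - (c * Q j a - s * Q j b) = c * A - s * B.
  by rewrite /A /B; ring.
have -> : s * Q i a + c * Q i b - (s * Q j a + c * Q j b) = s * A + c * B.
  by rewrite /A /B; ring.
apply/eqP; transitivity ((c ^+ 2 + s ^+ 2 - 1) * (A * A + B * B)); first by ring.
by rewrite cs subrr mul0r.
Qed.

(** The maximum of the linear form on the circle is the length of [(al, be)]; if it is attained at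
    [(1, 0)], then [be = 0]. This replaces differentiation with respect to a rotation angle. *)
Lemma unit_circle_max (al be : R) :
  (forall c s, c ^+ 2 + s ^+ 2 = 1 -> c * al + s * be <= al) -> be = 0.
Proof.
move=> h; pose g2 := al ^+ 2 + be ^+ 2.
have g20 : 0 <= g2 by rewrite addr_ge0 // sqr_ge0.
have [g0|gn0] := eqVneq g2 0.
  have : be ^+ 2 <= 0 by have := sqr_ge0 al; move: g0; rewrite /g2; lra.
  by move=> b2; apply/eqP; rewrite -sqrf_eq0 eq_le b2 sqr_ge0.
pose g := Num.sqrt g2; have gg : g ^+ 2 = g2 by rewrite sqr_sqrtr.
have gp : 0 < g by rewrite sqrtr_gt0 lt_def gn0.
have gn : g != 0 by rewrite gt_eqF.
have := h (al / g) (be / g).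
have -> : (al / g) ^+ 2 + (be / g) ^+ 2 = g2 / g ^+ 2 by rewrite /g2; field.
rewrite gg divff // => /(_ erefl).
have -> : al / g * al + be / g * be = g2 / g by rewrite /g2; field.
rewrite -gg expr2 mulfK // => gal.
have : g2 <= al ^+ 2 by rewrite -gg; nra.
rewrite /g2 => b2; apply/eqP; rewrite -sqrf_eq0 eq_le sqr_ge0 andbT; lra.
Qed.

Definition nearest_formation P Q := formation G d Q /\
  forall Q', formation G d Q' -> dot (P - Q) (P - Q) <= dot (P - Q') (P - Q').

Lemma nearest_motion_free P Q : nearest_formation P Q -> motion_free Q (P - Q).
Proof.
move=> [hQ hmin]; have [N0|N0] := posnP N.
  split=> [a|a b].
    by rewrite big1 // => i; case: i => i iN; exfalso; rewrite N0 in iN.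
  by rewrite !big1 // => i; case: i => i iN; exfalso; rewrite N0 in iN.
split=> [a|a b].
  set S := \sum_i _.
  have Np : 0 < (N%:R : R) by rewrite ltr0n.
  (* Translating by the mean of the column would lower the squared distance by [S ^+ 2 / N]. *)
  have := hmin _ (formation_shift a (S / N%:R) hQ).
  rewrite -subr_ge0.
  have -> : dot (P - shift_col a (S / N%:R) Q) (P - shift_col a (S / N%:R) Q) -
      dot (P - Q) (P - Q) = - (S ^+ 2 / N%:R).
    rewrite /dot -sumrB; set s := S / N%:R.
    transitivity (\sum_i (- (2 * s) * (P - Q) i a + s ^+ 2)).
      apply: eq_bigr => i _; rewrite -sumrB (bigD1 a) //= big1 ?addr0.
        by rewrite !mxE eqxx mul1r; ring.
      by move=> e /negbTE ea; rewrite !mxE ea mul0r addr0 subrr.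
    rewrite big_split /= -mulr_sumr -/S sumr_const card_ord -[X in _ + X]mulr_natr /s.
    by field; rewrite gt_eqF.
  rewrite oppr_ge0 pmulr_lle0 ?invr_gt0 // => h.
  by apply/eqP; rewrite -sqrf_eq0 eq_le h sqr_ge0.
have [->//|ab] := eqVneq a b.
(* Rotating [Q] in the plane of [a] and [b] changes its pairing with [P] in these two coordinates
   from [al] to [c * al + s * be]. *)
pose al := \sum_i (P i a * Q i a + P i b * Q i b).
pose be := \sum_i (P i b * Q i a - P i a * Q i b).
have be0 : be = 0.
  apply: (@unit_circle_max al) => c s cs.
  have := hmin _ (formation_rotation ab cs hQ); rewrite -subr_ge0.
  have -> : dot (P - plane_rotation a b c s Q) (P - plane_rotation a b c s Q) -
      dot (P - Q) (P - Q) = 2 * (al - (c * al + s * be)).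
    rewrite /dot -sumrB /al /be !mulr_sumr -big_split -sumrB mulr_sumr.
    apply: eq_bigr => i _ /=; rewrite (sum_diff2 ab).
      rewrite !mxE !eqxx (eq_sym b) (negbTE ab).
      transitivity (2 * (P i a * Q i a + P i b * Q i b -
        (c * (P i a * Q i a + P i b * Q i b) + s * (P i b * Q i a - P i a * Q i b)))
        + (c ^+ 2 + s ^+ 2 - 1) * (Q i a ^+ 2 + Q i b ^+ 2)); first by ring.
      by rewrite cs subrr mul0r addr0.
    by move=> e ea eb; rewrite !mxE (negbTE ea) (negbTE eb).
  by rewrite pmulr_rge0 // subr_ge0.
apply/eqP; rewrite -subr_eq0 -sumrB; apply/eqP; transitivity be => //.
by rewrite /be; apply: eq_bigr => i _; rewrite !mxE; ring.
Qed.

Lemma cont_mx_cst (T : topologicalType) P : cont_mx (fun _ : T => P).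
Proof. by move=> i a; exact: contC. Qed.

(** The set of formations is unbounded, but only those no farther from [P] than a given one compete,
    and they form a compact set. *)
Lemma nearest_formation_exists P : (exists Q, formation G d Q) ->
  exists Q, nearest_formation P Q.
Proof.
move=> [Q0 hQ0]; pose c0 := dot (P - Q0) (P - Q0).
pose A := [set q : 'rV[R]_(N * n) | pot G d (vec_mx q) <= 0] `&`
  [set q | dot (P - vec_mx q) (P - vec_mx q) <= c0].
have cPq : cont_mx (fun q : 'rV[R]_(N * n) => P - vec_mx q).
  by apply: cont_mxB; [exact: cont_mx_cst|exact: cont_vec_mx].
have hcont : continuous (fun q : 'rV[R]_(N * n) => dot (P - vec_mx q) (P - vec_mx q)).
  exact: cont_dot.
have cA : closed A.
  apply: closedI; apply: closed_sublevel => //.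
  by apply: cont_pot; exact: cont_vec_mx.
have bA q : A q -> `|q| <= `|mxvec P| + (c0 + 1).
  move=> [_ hq]; have -> : q = mxvec P - (mxvec P - q) by rewrite opprB addrC subrK.
  apply: le_trans (ler_normB _ _) _; rewrite lerD2l; apply: norm_le_dot.
  by rewrite linearB /= mxvecK.
have [|q [hq1 hq2] qmin] := compact_argmin cA bA _ hcont.
  exists (mxvec Q0); split; rewrite /= mxvecK //; exact/formation_pot.
exists (vec_mx q); split; first exact/formation_pot.
move=> Q' hQ'; have [h|h] := leP (dot (P - Q') (P - Q')) c0.
  have := qmin (mxvec Q'); rewrite mxvecK; apply; split; rewrite /= mxvecK //.
  exact/formation_pot.
exact: le_trans hq2 (ltW h).
Qed.

Section Rigid.
Hypothesis n_gt0 : (0 < n)%N.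
Variable i0 : 'I_N.
Hypothesis formation_ex : exists Q, formation G d Q.
Hypothesis rigid : forall Q U, formation G d Q -> motion_free Q U ->
  (forall i j, adj G i j -> edot Q U i j = 0) -> U = 0.

(** The pinned configurations with [pot <= 1] that stay at squared distance at least [e] from all
    formations form a compact set on which [pot] has a positive lower bound [c]; below [c / 2] a
    pinned configuration must leave this set. Recentering handles the general case. *)
Lemma sublevel_near_formation (e : R) : 0 < e -> exists L, [/\ 0 < L, L <= 1 &
  forall P, pot G d P <= L -> exists2 Q, formation G d Q & dot (P - Q) (P - Q) <= e].
Proof.
move=> e0; have [b b0 hb] := sublevel_bounded n_gt0 i0 formation_ex rigid.
pose A := [set p : 'rV[R]_(N * n) | forall a, vec_mx p i0 a ^+ 2 <= 0] `&`
  ([set p | pot G d (vec_mx p) <= 1] `&`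
   [set p | forall Q, formation G d Q ->
      - dot (vec_mx p - Q) (vec_mx p - Q) <= - e]).
have cA : closed A.
  apply: closedI; last apply: closedI.
  - apply: closed_forall => a; apply: closed_sublevel; apply: contX2.
    exact: cont_vec_mx.
  - by apply: closed_sublevel; apply: cont_pot; exact: cont_vec_mx.
  apply: closed_forall => Q; apply: closed_forall => _; apply: closed_sublevel.
  have h : continuous (fun p : 'rV[R]_(N * n) => dot (vec_mx p - Q) (vec_mx p - Q)).
    by apply: cont_dot; apply: cont_mxB; [exact: cont_vec_mx|exact: cont_mx_cst
      |exact: cont_vec_mx|exact: cont_mx_cst].
  rewrite (_ : (fun x => _) = (fun p : 'rV[R]_(N * n) =>
    0 - dot (vec_mx p - Q) (vec_mx p - Q))); first exact: (contB (@contC _ _ 0) h).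
  by apply/funext => p; rewrite sub0r.
have bA p : A p -> `|p| <= b + 1.
  move=> [h0 [h1 _]]; apply: norm_le_dot; apply: hb => // a.
  by apply/eqP; rewrite -sqrf_eq0 eq_le sqr_ge0 andbT; exact: h0.
have hcont : continuous (fun p : 'rV[R]_(N * n) => pot G d (vec_mx p)).
  by apply: cont_pot; exact: cont_vec_mx.
have [|c c0 hc] := compact_lower_bound cA bA hcont.
  move=> p [_ [_ hp]]; rewrite ltNge; apply/negP => /formation_pot hf.
  have := hp _ hf; rewrite subrr /dot big1 ?oppr0; first by lra.
  by move=> i _; rewrite big1 // => a _; rewrite mxE mul0r.
exists (Num.min 1 (c / 2)); split; first by rewrite lt_min ltr01 divr_gt0.
  by rewrite ge_min lexx.
move=> P; rewrite le_min => /andP[P1 Pc].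
have : ~ A (mxvec (recenter i0 P)).
  by move=> /hc; rewrite mxvecK pot_recenter; lra.
move=> nA; have [[Q hQ hd]|h] := pselect (exists2 Q, formation G d Q &
    dot (recenter i0 P - Q) (recenter i0 P - Q) <= e).
  exists (\matrix_(i, a) (Q i a + P i0 a)).
    by move=> i j aij; rewrite -hQ //; apply: eq_bigr => a _; rewrite !mxE; ring.
  rewrite (_ : P - _ = recenter i0 P - Q) //.
  by apply/matrixP => i a; rewrite !mxE; ring.
case: nA; split.
  by move=> a; rewrite mxvecK recenter_base expr0n.
split; first by rewrite /= mxvecK pot_recenter.
move=> Q hQ; rewrite mxvecK lerN2 leNgt; apply/negP => /ltW hd.
by apply: h; exists Q.
Qed.

(* Lojasiewicz inequality with exponent 1/2, uniform on a sublevel set. *)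
Theorem gradient_dominates_potential : exists L kappa, [/\ 0 < L, L <= 1,
  0 < kappa & forall P, pot G d P <= L ->
  pot G d P <= kappa * dot (grad G d P) (grad G d P)].
Proof.
have [c c0 hc] := rigidity_constant n_gt0 i0 formation_ex rigid.
have N1 : 0 < 32 * N%:R ^+ 2 + 1 :> R by rewrite ltr_wpDl // mulr_ge0 // sqr_ge0.
have [L [L0 L1 hL]] := sublevel_near_formation (divr_gt0 c0 N1).
exists L, (16 / c); split=> //; first by rewrite divr_gt0.
move=> P /hL[Q0 hQ0 hd].
(* The formation [Q0] only supplies closeness. The nearest one is at least as close and in addition
   makes [P - Q] motion-free, as the rigidity constant requires. *)
have [Q hQ] := nearest_formation_exists P formation_ex.
have mQ := nearest_motion_free hQ.
apply: (lojasiewicz_local c0 hQ.1 (hc _ _ hQ.1 mQ)).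
have h := le_trans (hQ.2 _ hQ0) hd.
apply: (@le_trans _ _ ((32 * N%:R ^+ 2 + 1) * (c / (32 * N%:R ^+ 2 + 1)))).
  by apply: ler_pM; rewrite ?dot_ge0 ?lerDl // mulr_ge0 // sqr_ge0.
by rewrite mulrCA divff ?mulr1 // gt_eqF.
Qed.

End Rigid.
End NearestFormation.

(** * The closed-loop system *)

Section LipschitzFunctions.
Context {R : realType} {m : nat}.
Implicit Types f g : 'rV[R]_m -> R.

(** The bound [C] accompanies the Lipschitz constant because products need both. *)
Definition lip_fun f := forall b : R, exists K C, [/\ 0 <= K, 0 <= C,
  forall u, `|u| <= b -> `|f u| <= C &
  forall u v, `|u| <= b -> `|v| <= b -> `|f u - f v| <= K * `|u - v|].

Lemma lip_funC c : lip_fun (fun=> c).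
Proof.
move=> b; exists 0, `|c|; split=> // u v _ _.
by rewrite subrr normr0 mul0r.
Qed.

Lemma lip_fun_coord c : lip_fun (fun u => u 0 c).
Proof.
move=> b; exists 1, `|b|; split=> //.
  by move=> u ub; apply: le_trans (rV_coord_le u c) (le_trans ub (ler_norm b)).
by move=> u v _ _; have := rV_coord_le (u - v) c; rewrite !mxE mul1r.
Qed.

Lemma lip_funD f g : lip_fun f -> lip_fun g -> lip_fun (fun u => f u + g u).
Proof.
move=> hf hg b; have [K [C [K0 C0 fC fK]]] := hf b.
have [K' [C' [K0' C0' gC gK]]] := hg b.
exists (K + K'), (C + C'); split; rewrite ?addr_ge0 //.
  by move=> u ub; apply: le_trans (ler_normD _ _) _; rewrite lerD ?fC ?gC.
move=> u v ub vb; rewrite opprD addrACA mulrDl.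
by apply: le_trans (ler_normD _ _) _; rewrite lerD ?fK ?gK.
Qed.

Lemma lip_funM f g : lip_fun f -> lip_fun g -> lip_fun (fun u => f u * g u).
Proof.
move=> hf hg b; have [K [C [K0 C0 fC fK]]] := hf b.
have [K' [C' [K0' C0' gC gK]]] := hg b.
exists (C * K' + C' * K), (C * C'); split; rewrite ?addr_ge0 ?mulr_ge0 //.
  by move=> u ub; rewrite normrM; apply: ler_pM; rewrite ?fC ?gC.
move=> u v ub vb.
have -> : f u * g u - f v * g v = f u * (g u - g v) + g v * (f u - f v) by ring.
apply: le_trans (ler_normD _ _) _; rewrite !normrM mulrDl -!mulrA.
by apply: lerD; apply: ler_pM; rewrite ?fC ?gC ?fK ?gK.
Qed.

Lemma lip_funB f g : lip_fun f -> lip_fun g -> lip_fun (fun u => f u - g u).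
Proof.
move=> hf hg; rewrite (_ : (fun u => _) = (fun u => f u + -1 * g u)).
  by apply: lip_funD => //; apply: lip_funM => //; exact: lip_funC.
by apply/funext => u; rewrite mulN1r.
Qed.

Lemma lip_fun_sum (I : finType) (P : pred I) (f : I -> 'rV[R]_m -> R) :
  (forall i, P i -> lip_fun (f i)) -> lip_fun (fun u => \sum_(i | P i) f i u).
Proof.
move=> hf; have -> : (fun u => \sum_(i | P i) f i u) = \sum_(i | P i) f i.
  by apply/funext => y; rewrite fct_sumE.
elim/big_ind : _ => // [|u v hu hv]; first exact: lip_funC.
exact: lip_funD.
Qed.

Lemma lipschitz_on_balls_coord (F : 'rV[R]_m -> 'rV[R]_m) :
  (forall c, lip_fun (fun u => F u 0 c)) -> lipschitz_on_balls F.
Proof.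
move=> hF b.
have hc c : exists K, 0 <= K /\ forall u v, `|u| <= b -> `|v| <= b ->
    `|F u 0 c - F v 0 c| <= K * `|u - v|.
  by have [K [C [K0 _ _ hK]]] := hF c b; exists K.
have [K hK] := choice hc.
have K0 : 0 <= \sum_c K c by apply: sumr_ge0 => c _; exact: (hK c).1.
exists (\sum_c K c + 1); first by rewrite ltr_wpDl.
move=> u v ub vb; apply/rV_normP; first by rewrite mulr_ge0 // addr_ge0.
move=> c; rewrite !mxE; apply: le_trans ((hK c).2 u v ub vb) _.
rewrite ler_wpM2r // (bigD1 c) //= -addrA lerDl addr_ge0 //.
by apply: sumr_ge0 => e _; exact: (hK e).1.
Qed.

End LipschitzFunctions.

Section MatrixPaths.
Context {R : realType}.
Variables (N n : nat) (G : {set {set 'I_N}}) (d : {set 'I_N} -> R).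
Implicit Types P U : R -> 'M[R]_(N, n).

Definition der_mx P (t : R) (P' : 'M[R]_(N, n)) :=
  forall i a, is_derive t (1 : R) (fun s => P s i a) (P' i a).

Lemma der_dot P U t (P' U' : 'M[R]_(N, n)) : der_mx P t P' -> der_mx U t U' ->
  is_derive t (1 : R) (fun s => dot (P s) (U s)) (dot (P t) U' + dot P' (U t)).
Proof.
move=> hP hU; rewrite /dot -big_split; apply: derive_pt_sum => i _ /=.
rewrite -big_split; apply: derive_pt_sum => a _ /=.
by apply: (is_derive_eq (derive_ptM (hP i a) (hU i a))); ring.
Qed.

Lemma der_err P t (P' : 'M[R]_(N, n)) i j : der_mx P t P' ->
  is_derive t (1 : R) (fun s => err d (P s) i j) (2 * edot (P t) P' i j).
Proof.
move=> hP; rewrite -[2 * _]subr0; apply: derive_ptB.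
rewrite /sqdist /edot mulr_sumr; apply: derive_pt_sum => a _.
have h := derive_ptB (hP i a) (hP j a).
by apply: (is_derive_eq (derive_ptM h h)); ring.
Qed.

Lemma der_pot P t (P' : 'M[R]_(N, n)) : der_mx P t P' ->
  is_derive t (1 : R) (fun s => pot G d (P s)) (dot P' (grad G d (P t))).
Proof.
move=> hP; rewrite dot_grad.
have hs i j := derive_ptM (der_err i j hP) (der_err i j hP).
apply: (is_derive_eq (derive_ptZ 8^-1 (derive_pt_sum (fun i (_ : true) =>
  derive_pt_sum (fun j (_ : adj G i j) => hs i j))))).
rewrite -/(edge_sum G (fun i j => err d (P t) i j * (2 * edot (P t) P' i j) +
  err d (P t) i j * (2 * edot (P t) P' i j))) -!edge_sumZ.
by apply: eq_edge_sum => i j _; field.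
Qed.

Lemma der_grad P t (P' : 'M[R]_(N, n)) : der_mx P t P' ->
  der_mx (fun s => grad G d (P s)) t (hess G d (P t) P').
Proof.
move=> hP i a; rewrite mxE.
rewrite (_ : (fun s => _) = (fun s => \sum_(j | adj G i j)
  err d (P s) i j * (P s i a - P s j a))); last first.
  by apply/funext => s; rewrite mxE.
by apply: derive_pt_sum => j _; exact: (derive_ptM (der_err i j hP)
  (derive_ptB (hP i a) (hP j a))).
Qed.

Lemma dot_young (A B : 'M[R]_(N, n)) : dot A B <= 2^-1 * (dot A A + dot B B).
Proof.
rewrite /dot -big_split mulr_sumr; apply: ler_sum => i _ /=.
rewrite -big_split mulr_sumr; apply: ler_sum => a _ /=.
by have := sqr_ge0 (A i a - B i a); nra.
Qed.

Lemma dotC (A B : 'M[R]_(N, n)) : dot A B = dot B A.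
Proof. by do 2!apply: eq_bigr => ? _; rewrite mulrC. Qed.

Lemma dotDl (A B C : 'M[R]_(N, n)) : dot (A + B) C = dot A C + dot B C.
Proof.
rewrite /dot -big_split; apply: eq_bigr => i _; rewrite -big_split.
by apply: eq_bigr => a _; rewrite mxE mulrDl.
Qed.

Lemma dotZl c (A B : 'M[R]_(N, n)) : dot (c *: A) B = c * dot A B.
Proof.
rewrite /dot mulr_sumr; apply: eq_bigr => i _; rewrite mulr_sumr.
by apply: eq_bigr => a _; rewrite mxE mulrA.
Qed.

Lemma dotNl (A B : 'M[R]_(N, n)) : dot (- A) B = - dot A B.
Proof. by rewrite -scaleN1r dotZl mulN1r. Qed.

End MatrixPaths.

Section ClosedLoop.
Context {R : realType}.
Variables (N n : nat) (G : {set {set 'I_N}}) (d : {set 'I_N} -> R) (r : 'I_N -> R).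
Local Notation m := (N * n)%N.
Implicit Types (x : 'rV[R]_(m + m)).

Definition pos x : 'M[R]_(N, n) := vec_mx (lsubmx x).
Definition vel x : 'M[R]_(N, n) := vec_mx (rsubmx x).

Definition damp (V : 'M[R]_(N, n)) : 'M[R]_(N, n) := \matrix_(i, a) (r i * V i a).

Definition field x : 'rV[R]_(m + m) :=
  row_mx (rsubmx x) (mxvec (- damp (vel x) - grad G d (pos x))).

Lemma pos_coord x i a : pos x i a = x 0 (lshift m (mxvec_index i a)).
Proof. by rewrite !mxE. Qed.

Lemma vel_coord x i a : vel x i a = x 0 (rshift m (mxvec_index i a)).
Proof. by rewrite !mxE. Qed.

Lemma field_pos x i a : field x 0 (lshift m (mxvec_index i a)) = vel x i a.
Proof. by rewrite row_mxEl !mxE. Qed.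

Lemma field_vel x i a : field x 0 (rshift m (mxvec_index i a)) =
  - (r i * vel x i a) - grad G d (pos x) i a.
Proof.
rewrite row_mxEr mxvecE mxE [(- damp _) _ _]mxE [(damp _) _ _]mxE.
by rewrite [(- grad _ _ _) _ _]mxE.
Qed.

Lemma coord_cases (T : 'I_(m + m) -> Prop) :
  (forall i a, T (lshift m (mxvec_index i a))) ->
  (forall i a, T (rshift m (mxvec_index i a))) -> forall c, T c.
Proof.
move=> hl hr c; rewrite -(splitK c); case: (fintype.split c) => k /=.
  by case/mxvec_indexP: k.
by case/mxvec_indexP: k.
Qed.

Lemma field_lipschitz : lipschitz_on_balls field.
Proof.
apply: lipschitz_on_balls_coord.
have lpos i a : lip_fun (fun x => pos x i a).
  by rewrite (_ : (fun x => _) = (fun x => x 0 (lshift m (mxvec_index i a))));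
    [exact: lip_fun_coord | apply/funext => x; exact: pos_coord].
have lvel i a : lip_fun (fun x => vel x i a).
  by rewrite (_ : (fun x => _) = (fun x => x 0 (rshift m (mxvec_index i a))));
    [exact: lip_fun_coord | apply/funext => x; exact: vel_coord].
apply: coord_cases => i a.
  rewrite (_ : (fun x => _) = (fun x => vel x i a)) //.
  by apply/funext => x; exact: field_pos.
rewrite (_ : (fun x => _) = (fun x => (0 - r i * vel x i a) -
  \sum_(j | adj G i j) err d (pos x) i j * (pos x i a - pos x j a))).
  apply: lip_funB.
    apply: lip_funB; first exact: lip_funC.
    by apply: lip_funM => //; exact: lip_funC.
  apply: lip_fun_sum => j _; apply: lip_funM; last exact: lip_funB.
  apply: lip_funB; last exact: lip_funC.
  by apply: lip_fun_sum => b _; apply: lip_funM; exact: lip_funB.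
by apply/funext => x; rewrite field_vel sub0r [X in _ - X]mxE.
Qed.

Lemma ode_scaled_der (s : R) (z : R -> 'rV[R]_(m + m)) t :
  ode_at (fun u => s *: field u) z t ->
  der_mx (fun t => pos (z t)) t (s *: vel (z t)) /\
  der_mx (fun t => vel (z t)) t (s *: (- damp (vel (z t)) - grad G d (pos (z t)))).
Proof.
move=> hz; split=> i a.
  rewrite (_ : (fun t => _) = (fun t => z t 0 (lshift m (mxvec_index i a)))).
    apply: (is_derive_eq (hz (lshift m (mxvec_index i a)))).
    by rewrite mxE field_pos [RHS]mxE.
  by apply/funext => u; exact: pos_coord.
rewrite (_ : (fun t => _) = (fun t => z t 0 (rshift m (mxvec_index i a)))).
  apply: (is_derive_eq (hz (rshift m (mxvec_index i a)))).
  rewrite mxE field_vel [RHS]mxE; congr (_ * _).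
  by rewrite [RHS]mxE [(- damp _) _ _]mxE [(damp _) _ _]mxE [(- grad _ _ _) _ _]mxE.
by apply/funext => u; exact: vel_coord.
Qed.

Definition state_energy x : R := 2^-1 * dot (vel x) (vel x) + pot G d (pos x).

Lemma state_energy_ge0 x : 0 <= state_energy x.
Proof. by rewrite addr_ge0 ?pot_ge0 // mulr_ge0 // dot_ge0. Qed.

(** The work of the potential force cancels the change of the potential, which leaves the friction
    alone; [s] again encodes the direction of time. *)
Lemma der_state_energy s z t : ode_at (fun u => s *: field u) z t ->
  is_derive t (1 : R) (fun t => state_energy (z t)) (- (s * dot (damp (vel (z t))) (vel (z t)))).
Proof.
move=> /ode_scaled_der[hp hv].
apply: (is_derive_eq (derive_ptD (derive_ptZ 2^-1 (der_dot hv hv)) (der_pot G d hp))).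
rewrite (dotC (vel _) (s *: _)) !dotZl dotDl !dotNl.
by rewrite (dotC (grad _ _ _)); field.
Qed.

Variables (rho rM : R).
Hypotheses (rho_gt0 : 0 < rho) (rM_gt0 : 0 < rM) (rho_le : forall i, rho <= r i)
  (rM_ge : forall i, r i <= rM).

Lemma damp_ge V : rho * dot V V <= dot (damp V) V.
Proof.
rewrite /dot mulr_sumr; apply: ler_sum => i _; rewrite mulr_sumr.
apply: ler_sum => a _; rewrite mxE -mulrA ler_wpM2r //.
by rewrite -expr2 sqr_ge0.
Qed.

Lemma damp_le V : dot (damp V) V <= rM * dot V V.
Proof.
rewrite /dot mulr_sumr; apply: ler_sum => i _; rewrite mulr_sumr.
apply: ler_sum => a _; rewrite mxE -mulrA ler_wpM2r //.
by rewrite -expr2 sqr_ge0.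
Qed.

Lemma damp_sqr_le V : dot (damp V) (damp V) <= rM ^+ 2 * dot V V.
Proof.
rewrite /dot mulr_sumr; apply: ler_sum => i _; rewrite mulr_sumr.
apply: ler_sum => a _; rewrite mxE mulrACA -expr2 ler_wpM2r //.
  by rewrite -expr2 sqr_ge0.
have r0 : 0 <= r i by exact: le_trans (ltW rho_gt0) (rho_le i).
by rewrite lerXn2r // nnegrE // (le_trans r0).
Qed.

Lemma derive_bound_interval (f df : R -> R) (c t : R) : 0 <= t ->
  (forall s, 0 <= s <= t -> is_derive s (1 : R) f (df s)) ->
  (forall s, 0 <= s <= t -> `|df s| <= c) -> `|f t - f 0| <= c * t.
Proof.
move=> t0 hf hc.
have dZ (s : R) : is_derive s (1 : R) (fun u => c * u) (c * 1).
  by apply: derive_ptZ.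
rewrite ler_norml; apply/andP; split.
- have : - f t - c * t <= - f 0 - c * 0.
    apply: (@derive_nonpos_le _ (fun t => - f t - c * t) (fun t => - df t - c * 1)) => // s st.
      have h := hf s st; exact: (derive_ptB (derive_ptN h) (dZ s)).
    by have := hc s st; rewrite ler_norml => /andP[]; lra.
  lra.
- have : f t - c * t <= f 0 - c * 0.
    apply: (@derive_nonpos_le _ (fun t => f t - c * t) (fun t => df t - c * 1)) => // s st.
      have h := hf s st; exact: (derive_ptB h (dZ s)).
    by have := hc s st; rewrite ler_norml => /andP[]; lra.
  lra.
Qed.

Lemma vel_le x i a : `|vel x i a| <= 2 * state_energy x + 1.
Proof.
have h : vel x i a ^+ 2 <= 2 * state_energy x.
  have := row_sqr_le (vel x) i; have := pot_ge0 G d (pos x).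
  have : vel x i a ^+ 2 <= \sum_b vel x i b ^+ 2.
    by rewrite (bigD1 a) //= lerDl sumr_ge0 // => b _; exact: sqr_ge0.
  rewrite /state_energy; lra.
have e0 := state_energy_ge0 x.
by rewrite ler_norml; apply/andP; split; nra.
Qed.

Lemma state_energy_growth s z t : `|s| = 1 -> 0 <= t ->
  (forall u, 0 <= u <= t -> ode_at (fun v => s *: field v) z u) ->
  state_energy (z t) <= state_energy (z 0) * expR (2 * rM * t).
Proof.
move=> s1 t0 hz.
apply: (gronwall_le t0 (fun u ut => der_state_energy (hz u ut))) => u ut.
have w0 := dot_ge0 (vel (z u)); have dg := damp_ge (vel (z u)).
have dl := damp_le (vel (z u)); have p0 := pot_ge0 G d (pos (z u)).
have r0 : 0 <= rho * dot (vel (z u)) (vel (z u)) by rewrite mulr_ge0 // ltW.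
have rM0 : 0 <= rM * pot G d (pos (z u)) by rewrite mulr_ge0 // ltW.
have sb : - (s * dot (damp (vel (z u))) (vel (z u))) <= dot (damp (vel (z u))) (vel (z u)).
  have := lerNnormlW (lexx `|s|); rewrite s1 => sl; nra.
rewrite /state_energy; lra.
Qed.

(** Energy sublevels are unbounded in position because of translations. The energy bounds the
    velocities only, and integrating them gives a bound on the positions that is linear in time. *)
Lemma field_global_solution x0 : exists y : R -> 'rV[R]_(m + m), y 0 = x0 /\
  forall t, ode_at field y t.
Proof.
apply: ode_global; first exact: field_lipschitz.
move=> T T0; pose ET := state_energy x0 * expR (2 * `|rM| * T).
have ET0 : 0 <= ET by rewrite mulr_ge0 ?state_energy_ge0 // expR_ge0.
exists (`|x0| + (2 * ET + 1) * T + (2 * ET + 1)) => z s t s1 /andP[t0 tT] z0 hz.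
have enb u : 0 <= u <= t -> state_energy (z u) <= ET.
  move=> /andP[u0 ut]; apply: le_trans (state_energy_growth s1 u0 _) _.
    by move=> v /andP[v0 vu]; apply: hz; rewrite v0 (le_trans vu).
  rewrite z0 ler_wpM2l ?state_energy_ge0 // ler_expR -!mulrA ler_wpM2l //.
  apply: (@le_trans _ _ (`|rM| * u)); first by rewrite ler_wpM2r // ler_norm.
  by rewrite ler_wpM2l // (le_trans ut).
have c0 : 0 <= 2 * ET + 1 by rewrite addr_ge0 // mulr_ge0.
apply/rV_normP; first by rewrite !addr_ge0 // mulr_ge0.
have cT : 0 <= (2 * ET + 1) * T by rewrite mulr_ge0.
apply: coord_cases => i a; last first.
  rewrite -vel_coord; apply: le_trans (vel_le _ _ _) _.
  have tt : 0 <= t <= t by rewrite t0 lexx.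
  have := enb t tt; have := normr_ge0 x0; lra.
have h : `|z t 0 (lshift m (mxvec_index i a)) - z 0 0 (lshift m (mxvec_index i a))| <=
    (2 * ET + 1) * t.
  apply: (derive_bound_interval t0 (fun u ut => hz u ut _)) => u ut.
  rewrite mxE field_pos normrM s1 mul1r; apply: le_trans (vel_le _ _ _) _.
  by have := enb u ut; lra.
have h2 := rV_coord_le x0 (lshift m (mxvec_index i a)); rewrite z0 in h.
have h3 : (2 * ET + 1) * t <= (2 * ET + 1) * T by rewrite ler_wpM2l.
set y1 := z t 0 _ in h *; set y0 := x0 0 _ in h h2 *.
have := ler_normD (y1 - y0) y0; rewrite subrK; lra.
Qed.

(* W = E + eps <v, grad V> is a strict Lyapunov function once the gradient
   dominates the potential. *)
Lemma energy_decay (dm L kappa : R) : 0 <= dm ->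
  (forall i j, adj G i j -> d [set i; j]%SET ^+ 2 <= dm) ->
  L <= 1 -> 0 < kappa ->
  (forall P : 'M[R]_(N, n), pot G d P <= L ->
     pot G d P <= kappa * dot (grad G d P) (grad G d P)) ->
  exists2 mu, 0 < mu & forall y : R -> 'rV[R]_(m + m),
    (forall t, ode_at field y t) -> state_energy (y 0) <= L ->
    forall t, 0 <= t -> state_energy (y t) <= 3 * state_energy (y 0) * expR (- mu * t).
Proof.
move=> dm0 hdm L1 k0 hk.
pose C1 : R := 8 * N%:R * (dm + 3); pose H : R := 4 * N%:R ^+ 2 * (dm + 5).
have C10 : 0 <= C1 by rewrite !mulr_ge0 // addr_ge0.
have H0 : 0 <= H by rewrite !mulr_ge0 ?sqr_ge0 // addr_ge0.
(* The three summands yield the three smallness conditions on [e = B^-1]: two make [W] comparable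
   with the energy, the third lets friction absorb the Hessian and damping terms. *)
pose B := 2 + C1 + (rM ^+ 2 + 2 * H) / rho.
have Bp : 0 <= (rM ^+ 2 + 2 * H) / rho.
  by rewrite divr_ge0 ?(ltW rho_gt0) // addr_ge0 ?sqr_ge0 // mulr_ge0.
have B0 : 0 < B by rewrite /B; lra.
pose e := B^-1; have e0 : 0 < e by rewrite invr_gt0.
have eB : e * B = 1 by rewrite mulVf // gt_eqF.
have ele (a : R) : a <= B -> e * a <= 1 by move=> aB; rewrite -[leRHS]eB ler_pM2l.
have e12 : 2 * e <= 1 by rewrite mulrC; apply: ele; rewrite /B; lra.
have eC1 : e * C1 <= 1 by apply: ele; rewrite /B; lra.
have eH : e * (rM ^+ 2 + 2 * H) <= rho.
  rewrite -[leRHS]mul1r -ler_pdivrMr // -mulrA; apply: ele.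
  by rewrite /B lerDr addr_ge0.
(* After absorption [dW] is at most [- rho / 2 * |v|^2 - e / 2 * |grad V|^2], and the gradient
   inequality turns this into [- mu0] times the energy. The factor [2 / 3] below passes from the
   energy to [W]. *)
pose mu0 := Num.min rho (e / (2 * kappa)).
have mu00 : 0 < mu0 by rewrite lt_min rho_gt0 divr_gt0 // mulr_gt0.
exists (2 / 3 * mu0); first by rewrite mulr_gt0.
move=> y hy yL.
have hy1 t : ode_at (fun u => 1 *: field u) y t.
  by move=> c; rewrite scale1r; exact: hy.
(* Energy does not increase, so the trajectory stays where the gradient inequality is available. *)
have enL t : 0 <= t -> state_energy (y t) <= L.
  move=> t0; apply: le_trans yL.
  apply: (derive_nonpos_le t0 (fun u _ => der_state_energy (hy1 u))) => u _.
  rewrite mul1r oppr_le0; apply: le_trans (damp_ge _).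
  by rewrite mulr_ge0 ?dot_ge0 // ltW.
pose W t := state_energy (y t) + e * dot (vel (y t)) (grad G d (pos (y t))).
(* The cross term is at most half the energy in absolute value; the factor 3 of the final estimate
   comes from here. *)
have cmp t : 0 <= t -> state_energy (y t) <= 2 * W t /\ 2 * W t <= 3 * state_energy (y t).
  move=> t0; have V1 : pot G d (pos (y t)) <= 1.
    apply: le_trans L1; apply: le_trans (enL t t0); rewrite /state_energy lerDr.
    by rewrite mulr_ge0 // dot_ge0.
  have gC := grad_sqr_le hdm dm0 V1; rewrite -/C1 in gC.
  have y1 := dot_young (vel (y t)) (grad G d (pos (y t))).
  have y2 := dot_young (- vel (y t)) (grad G d (pos (y t))).
  rewrite !dotNl (dotC (vel _) (- vel _)) dotNl opprK in y2.
  have w0 := dot_ge0 (vel (y t)); have p0 := pot_ge0 G d (pos (y t)).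
  rewrite /W /state_energy.
  move: gC y1 y2 w0 p0; set w := dot (vel _) (vel _); set q := pot _ _ _.
  set g := dot (grad _ _ _) _; set c := dot _ _ => gC y1 y2 w0 p0.
  have h1 : e * g <= q.
    apply: (@le_trans _ _ (e * (C1 * q))); first by rewrite ler_pM2l.
    by rewrite mulrA ler_piMl.
  have h2 : 2 * (e * w) <= w by rewrite mulrA ler_piMl.
  have h3 : e * c <= 2^-1 * (e * w + e * g) by rewrite -mulrDr mulrCA ler_pM2l.
  have h4 : - (e * c) <= 2^-1 * (e * w + e * g).
    by rewrite -mulrN -mulrDr mulrCA ler_pM2l.
  by split; lra.
pose dW t := - dot (damp (vel (y t))) (vel (y t)) +
  e * (dot (vel (y t)) (hess G d (pos (y t)) (vel (y t))) +
       dot (- damp (vel (y t)) - grad G d (pos (y t))) (grad G d (pos (y t)))).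
have hW (t : R) : is_derive t (1 : R) W (dW t).
  have [hp hv] := ode_scaled_der (hy1 t); rewrite !scale1r in hp hv.
  have := derive_ptD (der_state_energy (hy1 t)) (derive_ptZ e (der_dot hv (der_grad G d hp))).
  by rewrite mul1r.
have dWle t : 0 <= t -> dW t <= - (2 / 3 * mu0) * W t.
  move=> t0; have VL : pot G d (pos (y t)) <= L.
    apply: le_trans (enL t t0); rewrite /state_energy lerDr.
    by rewrite mulr_ge0 // dot_ge0.
  have V1 := le_trans VL L1; have kg := hk _ VL.
  have hh := hess_form_le hdm (vel (y t)) dm0 V1; rewrite -/H in hh.
  have dg := damp_ge (vel (y t)).
  have ds := damp_sqr_le (vel (y t)).
  have y2 := dot_young (- damp (vel (y t))) (grad G d (pos (y t))).
  rewrite !dotNl (dotC (damp _) (- damp _)) dotNl opprK in y2.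
  have [_ c2] := cmp t t0; move: c2.
  rewrite /dW dotDl !dotNl.
  have w0 := dot_ge0 (vel (y t)); have p0 := pot_ge0 G d (pos (y t)).
  rewrite /state_energy; move: kg hh dg ds y2 w0 p0; move: (W t) => Wt.
  set w := dot (vel _) (vel _); set q := pot _ _ _; set h := dot _ (hess _ _ _ _).
  set g := dot (grad _ _ _) (grad _ _ _); set D := dot (damp _) (vel _).
  set DD := dot (damp _) (damp _); set c := dot _ (grad _ _ _).
  move=> kg hh dg ds y2 w0 p0 c2.
  have k1 : e / (2 * kappa) * q <= e / 2 * g.
    have -> : e / 2 * g = e / (2 * kappa) * (kappa * g) by field; rewrite gt_eqF.
    by rewrite ler_wpM2l // divr_ge0 ?ltW // mulr_gt0.
  have m1 : mu0 * w <= rho * w by rewrite ler_wpM2r // ge_min lexx.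
  have m2 : mu0 * q <= e / (2 * kappa) * q.
    by rewrite ler_wpM2r // ge_min lexx orbT.
  have e1 : e * h <= e * (H * w) by rewrite ler_pM2l.
  have e2 : e * (- c) <= e * (2^-1 * (rM ^+ 2 * w + g)).
    by rewrite ler_pM2l //; lra.
  have e3 : e * (rM ^+ 2 + 2 * H) * w <= rho * w by rewrite ler_wpM2r.
  have m3 : mu0 * (2 * Wt) <= mu0 * (3 * (2^-1 * w + q)) by rewrite ler_pM2l.
  lra.
move=> t t0.
have h : W t <= W 0 * expR (- (2 / 3 * mu0) * t).
  apply: (gronwall_le t0 (fun u _ => hW u)) => u /andP[u0 _].
  exact: dWle.
have [c1 _] := cmp t t0; have [_ c2] := cmp 0 (lexx 0).
apply: (le_trans c1).
apply: (@le_trans _ _ (2 * W 0 * expR (- (2 / 3 * mu0) * t))).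
  by rewrite -mulrA ler_wpM2l.
by rewrite ler_wpM2r // expR_ge0.
Qed.

End ClosedLoop.

(** * Maximal solutions of the closed-loop system *)

Section Solutions.
Context {R : realType}.
Variables (N n : nat) (G : {set {set 'I_N}}) (d : {set 'I_N} -> R) (r : 'I_N -> R).
Hypothesis G_edges : forall e : {set 'I_N}, e \in G -> #|e| = 2%N.
Local Notation m := (N * n)%N.
Implicit Types (x : R -> 'rV[R]_(m + m)).

Lemma energyE (x0 : 'rV[R]_(m + m)) : energy G d x0 = state_energy G d x0.
Proof.
rewrite /energy /state_energy potentialE //; congr (_ * _ + _).
rewrite enorm_sqr /dot pair_bigA /=.
rewrite (reindex _ (curry_mxvec_bij N n)) /=.
by apply: eq_bigr => -[i a] _; rewrite /= !mxE expr2.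
Qed.

Lemma is_derive_rV k (f : R -> 'rV[R]_k) (t : R) (D : 'rV[R]_k) :
  is_derive t (1 : R) f D <->
  forall a, is_derive t (1 : R) (fun s => f s 0 a) (D 0 a).
Proof.
split=> [[df <-] a|h].
  apply: DeriveDef; first exact: (derivable_mxP f t 1).1 df 0 a.
  by rewrite derive_mx // mxE.
have df : derivable f t 1.
  by apply/derivable_mxP => i a; rewrite (ord1 i); have [] := h a.
apply: DeriveDef => //; rewrite derive_mx //; apply/rowP => a; rewrite mxE.
by have [_] := h a.
Qed.

Lemma solution_ode (x0 : 'rV[R]_(m + m)) (J : set R) x : is_solution G d r x0 J x <->
  [/\ open J, is_interval J, J 0, x 0 = x0 &
      forall t, J t -> ode_at (field G d r) x t].
Proof.
have posE i a : (fun s => block (lsubmx (x s)) i 0 a) =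
    (fun s => x s 0 (lshift m (mxvec_index i a))).
  by apply/funext => s; rewrite !mxE.
have velE i a : (fun s => block (rsubmx (x s)) i 0 a) =
    (fun s => x s 0 (rshift m (mxvec_index i a))).
  by apply/funext => s; rewrite !mxE.
have posD t i a : block (rsubmx (x t)) i 0 a =
    field G d r (x t) 0 (lshift m (mxvec_index i a)).
  by rewrite field_pos !mxE.
have velD t i a : (- (r i *: block (rsubmx (x t)) i)
    - block_gradient i (local_potential G d i) (lsubmx (x t))) 0 a =
    field G d r (x t) 0 (rshift m (mxvec_index i a)).
  rewrite field_vel block_gradientE // mxE; congr (_ + _); first by rewrite !mxE.
  by rewrite mxE [(row _ _) _ _]mxE.
split=> -[oJ iJ J0 xx0 h]; split=> // t.
  move=> Jt; apply: coord_cases => i a; have [hp hv] := h t i Jt.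
    by rewrite -posD -posE; exact: ((is_derive_rV _ _ _).1 hp a).
  by rewrite -velD -velE; exact: ((is_derive_rV _ _ _).1 hv a).
move=> i Jt; split; apply/is_derive_rV => a.
  by rewrite posD posE; exact: h.
by rewrite velD velE; exact: h.
Qed.

End Solutions.

Theorem mainTheorem1 (R : realType) (n N : nat) (n_gt0 : (0 < n)%N)
    (N_ge_n : (n <= N)%N)
    (G : {set {set 'I_N}})
    (G_edges : forall e : {set 'I_N}, e \in G -> #|e| = 2%N)
    (G_nonempty : G <> finset.set0)
    (d : {set 'I_N} -> R) (d_gt0 : forall e : {set 'I_N}, e \in G -> 0 < d e)
    (d_realizable : exists p : 'rV[R]_(N * n), desired_formations G d p)
    (r : 'I_N -> R) (r_gt0 : forall i : 'I_N, 0 < r i)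
    (rigid : forall p : 'rV[R]_(N * n),
       desired_formations G d p -> infinitesimally_rigid G p) :
  exists L lambda mu : R,
    [/\ 0 < L, 0 < lambda, 0 < mu &
      forall x0 : 'rV[R]_(N * n + N * n), energy G d x0 <= L ->
        (exists (J : set R) (x : R -> 'rV[R]_(N * n + N * n)),
           is_maximal_solution G d r x0 J x) /\
        (forall (J : set R) (x : R -> 'rV[R]_(N * n + N * n)),
           is_maximal_solution G d r x0 J x ->
           forall t : R, 0 <= t ->
             J t /\ energy G d (x t) <= lambda * energy G d x0 * expR (- mu * t))].
Proof.
have i0 : 'I_N by exact: (Ordinal (leq_trans n_gt0 N_ge_n)).
have formP (Q : 'M[R]_(N, n)) : formation G d Q -> desired_formations G d (mxvec Q).
  by move=> hQ; apply/(desired_formationsP d_gt0); rewrite mxvecK.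
have form_ex : exists Q : 'M[R]_(N, n), formation G d Q.
  have [p hp] := d_realizable.
  by exists (vec_mx p); exact: (desired_formationsP d_gt0 p).1.
have rig (Q U : 'M[R]_(N, n)) : formation G d Q -> motion_free Q U ->
    (forall i j, adj G i j -> edot Q U i j = 0) -> U = 0.
  move=> hQ mU eU; apply: (rigid_motion_free n_gt0 N_ge_n (rigid _ (formP Q hQ)));
    by rewrite mxvecK.
have [L [kappa [L0 L1 k0 hk]]] := gradient_dominates_potential n_gt0 i0 form_ex rig.
pose dm := \sum_i \sum_j d [set i; j]%SET ^+ 2.
have dm0 : 0 <= dm by do 2!apply: sumr_ge0 => ? _; exact: sqr_ge0.
have hdm i j : adj G i j -> d [set i; j]%SET ^+ 2 <= dm.
  move=> _; rewrite /dm (bigD1 i) //= (bigD1 j) //= -addrA lerDl.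
  by rewrite addr_ge0 //; do ?[apply: sumr_ge0 => ? _]; exact: sqr_ge0.
(* Sums replace extrema: the sum dominates every [r i], and the inverse of the sum of inverses lies
   below every [r i]. *)
pose rM := \sum_i r i; pose rho := (\sum_i (r i)^-1)^-1.
have rM0 : 0 < rM.
  rewrite /rM (bigD1 i0) //= ltr_pwDl // sumr_ge0 // => i _; exact: ltW.
have S0 : 0 < \sum_i (r i)^-1.
  rewrite (bigD1 i0) //= ltr_pwDl ?invr_gt0 // sumr_ge0 // => i _.
  by rewrite invr_ge0 ltW.
have rho0 : 0 < rho by rewrite invr_gt0.
have rho_le i : rho <= r i.
  rewrite -[r i]invrK lef_pV2 ?posrE ?invr_gt0 //.
  rewrite (bigD1 i) //= lerDl sumr_ge0 // => k _.
  by rewrite invr_ge0 ltW.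
have rM_ge i : r i <= rM.
  by rewrite /rM (bigD1 i) //= lerDl sumr_ge0 // => k _; exact: ltW.
have [mu mu0 decay] :=
  energy_decay rho0 rho_le rM_ge dm0 hdm L1 k0 hk.
exists L, 3, mu; split=> // x0 x0L.
have [y [y0 hy]] := field_global_solution G d rho0 rM0 rho_le rM_ge x0.
have y_sol : is_solution G d r x0 setT y.
  apply/(solution_ode d r G_edges); split=> //; exact: openT.
split.
  exists setT, y; split=> // J' x' _ TJ _.
  by apply/seteqP; split=> // t _; exact: TJ.
move=> J x [/(solution_ode d r G_edges) [oJ iJ J0 xx0 hx] xmax] t t0.
(* An interval containing 0 and [u] contains the segment between them, so uniqueness applies on it.
   Thus [y] extends [x], and maximality forces [J] to be the whole line. *)
have xy u : J u -> y u = x u.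
  move=> Ju; apply: (ode_unique (field_lipschitz n G d r)); first by rewrite y0 xx0.
    by move=> v _; exact: hy.
  move=> v /orP[|] vu; apply: hx; [exact: (iJ 0 u)|exact: (iJ u 0)].
have JT : setT = J by apply: (xmax setT y) => // u Ju; exact: xy.
have hx' u : ode_at (field G d r) x u by apply: hx; rewrite -JT.
split; first by rewrite -JT.
rewrite !energyE //; have := decay x hx' _ t t0; rewrite xx0; apply.
by rewrite -energyE.
Qed.
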